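(* Let $m,n\geq 1$ and put $\mathfrak m=\max(m,n)$. If $\mathfrak m\geq 3$, then the bigraded path homology of the bi-directed cycle $C_{m,n}$, regarded as the page $E^2_{*,*}(C_{m,n})$ of the magnitude-path spectral sequence with its spectral sequence bigrading, is concentrated in bidegrees $(0,0)$, $(1,0)$ and $(\mathfrak m,-(\mathfrak m-2))$, in each of which it is a free $R$-module of rank $1$. Moreover, the magnitude-path spectral sequence of $C_{m,n}$ satisfies $E^2(C_{m,n})=\cdots=E^{\mathfrak m-1}(C_{m,n})$, while $E^{\mathfrak m}(C_{m,n})$ is trivial, consisting of a single copy of $R$ in bidegree $(0,0)$. If $\mathfrak m=1$ or $\mathfrak m=2$, then the bigraded path homology is concentrated in bidegree $(0,0)$, where it is free of rank $1$.
   Context: Fix a commutative ground ring $R$. A directed graph $G$ has a vertex set $V(G)$ and edge set $E(G)\subseteq V(G)\times V(G)$ (no parallel edges). The distance $d(x,y)\in\{0,1,\dots,\infty\}$ is the minimal number of edges in a directed path from $x$ to $y$. The bi-directed cycle $C_{m,n}$ ($m,n\geq1$) is obtained from a directed interval with $m$ edges and a directed interval with $n$ edges by identifying their initial vertices to a single vertex and their final vertices to a single vertex. The reachability complex $\mathrm{RC}_*(G)$ has in degree $k$ the free $R$-module on tuples $(x_0,\dots,x_k)$ of vertices with consecutive entries distinct and $d(x_i,x_{i+1})<\infty$ for all $i$; its differential is $\sum_{i=0}^k(-1)^i(x_0,\dots,\widehat{x_i},\dots,x_k)$, omitting terms with repeated consecutive entries. The length of a tuple is $\ell(x_0,\dots,x_k)=\sum_i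 d(x_i,x_{i+1})$, and $F_\ell\mathrm{RC}_*(G)$ is spanned by tuples of length at most $\ell$. The magnitude-path spectral sequence $\{E^r_{*,*}(G),d^r\}_{r\geq0}$ is the spectral sequence of this filtered complex, with $E^0_{i,j}(G)=F_i\mathrm{RC}_{i+j}(G)/F_{i-1}\mathrm{RC}_{i+j}(G)$ and $d^r$ of bidegree $(-r,r-1)$. Bigraded path homology is $\mathrm{PH}_{k,\ell}(G)=E^2_{\ell,k-\ell}(G)$, so that $E^2_{i,j}(G)=\mathrm{PH}_{i+j,i}(G)$. *)

(* Defs.v *)
From HB Require Import structures.
From mathcomp Require Import all_boot all_order all_algebra.
From mathcomp Require Import generic_quotient ring_quotient finmap boolp monalg.
From mathcomp Require Import zify.

Set Implicit Arguments.
Unset Strict Implicit.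
Unset Printing Implicit Defensive.

Import Order.TTheory GRing.Theory Num.Theory.

Local Open Scope ring_scope.
Local Open Scope quotient_scope.

Section Submodule.
Context (R : comNzRingType) (V : lmodType R).

Definition submodule (Z : submodClosed V) := {x : V | x \in Z}.
HB.instance Definition _ Z := SubChoice.on (submodule Z).
HB.instance Definition _ Z := [SubChoice_isSubLmodule of submodule Z by <:].

End Submodule.

Section LQuotient.
Context (R : comNzRingType) (V : lmodType R) (I : submodClosed V).

Definition lquot_rel : {pred V} := [pred x | x \in I].

Fact lquot_rel_closed : zmod_closed lquot_rel.
Proof. exact: GRing.submod_closedB (submodClosedP I). Qed.
HB.instance Definition _ := GRing.isZmodClosed.Build V lquot_rel lquot_rel_closed.

Definition lquot := Quotient.quot lquot_rel.
HB.instance Definition _ := EqQuotient.on lquot.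
HB.instance Definition _ := GRing.Zmodule.on lquot.

Definition lquot_scale (a : R) (x : lquot) : lquot := \pi_lquot (a *: repr x).

Lemma lquot_eqP (x y : V) :
  (\pi_lquot x = \pi_lquot y) <-> (x - y \in I).
Proof.
rewrite -[_ \in I]/(x - y \in lquot_rel) Quotient.idealrBE; split; first by move=> e; apply/eqP.
by move/eqP.
Qed.

Lemma lquot_piD (x y : V) : \pi_lquot (x + y) = \pi_lquot x + \pi_lquot y.
Proof. exact: (@raddfD _ _ (\pi_(Quotient.quot lquot_rel))). Qed.

Lemma lquot_scale_pi a x : lquot_scale a (\pi x) = \pi_lquot (a *: x).
Proof.
apply/lquot_eqP; rewrite -scalerBr rpredZ //.
by apply/lquot_eqP; rewrite reprK.
Qed.

Fact lquot_scaleA a b x :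
  lquot_scale a (lquot_scale b x) = lquot_scale (a * b) x.
Proof. by rewrite -[x]reprK !lquot_scale_pi scalerA. Qed.

Fact lquot_scale1 : left_id 1 lquot_scale.
Proof. by move=> x; rewrite -[x]reprK lquot_scale_pi scale1r. Qed.

Fact lquot_scaleDr : right_distributive lquot_scale +%R.
Proof.
move=> a x y; rewrite -[x]reprK -[y]reprK.
by rewrite -lquot_piD !lquot_scale_pi -lquot_piD scalerDr.
Qed.

Fact lquot_scaleDl x : {morph lquot_scale^~ x : a b / a + b}.
Proof.
move=> a b; rewrite -[x]reprK.
by rewrite !lquot_scale_pi -lquot_piD scalerDl.
Qed.

HB.instance Definition _ := GRing.Zmodule_isLmodule.Build R lquot
  lquot_scaleA lquot_scale1 lquot_scaleDr lquot_scaleDl.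

Lemma lquot_piZ a x : \pi_lquot (a *: x) = a *: \pi_lquot x.
Proof. by rewrite -lquot_scale_pi. Qed.

End LQuotient.

(* [subquot Z B] is Z / (Z :&: B); it is only used when B is contained in Z. *)
Section Subquotient.
Context (R : comNzRingType) (V : lmodType R) (Z B : submodClosed V).

Definition subquot_rel : {pred submodule Z} := [pred z | val z \in B].

Fact subquot_rel_closed : submod_closed subquot_rel.
Proof.
split=> [|a x y]; rewrite !inE; first exact: rpred0.
by move=> Bx By; rewrite /= rpredD // rpredZ.
Qed.
HB.instance Definition _ :=
  GRing.isSubmodClosed.Build R (submodule Z) subquot_rel subquot_rel_closed.

Definition subquot : lmodType R := lquot subquot_rel.
Definition subquot_class (z : submodule Z) : subquot := \pi_(lquot _) z.

Lemma subquot_classP (x y : submodule Z) :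
  (subquot_class x = subquot_class y) <-> (val x - val y \in B).
Proof. by rewrite lquot_eqP inE. Qed.

Lemma subquot_classE (e : subquot) : exists z, e = subquot_class z.
Proof. by exists (repr e); rewrite /subquot_class reprK. Qed.

Lemma subquot_class_linear : linear subquot_class.
Proof. by move=> a x y; rewrite /subquot_class lquot_piD lquot_piZ. Qed.
HB.instance Definition _ :=
  GRing.isLinear.Build R (submodule Z) subquot _ subquot_class
    subquot_class_linear.

End Subquotient.

(* A filtered chain complex is carried by one ambient module containing all
   degrees at once: [fc_fil p n] is the filtration step F_p C_n of the degree-n
   part. *)
Record filteredComplex (R : comNzRingType) := FilteredComplex {
  fc_sort : lmodType R;
  fc_diff : {linear fc_sort -> fc_sort};
  fc_fil : int -> int -> submodClosed fc_sort;
  fc_fil_mono : forall p p' n, p <= p' -> {subset fc_fil p n <= fc_fil p' n};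
  fc_diff_fil : forall p n c, c \in fc_fil p n -> fc_diff c \in fc_fil p (n - 1);
  fc_diffK : forall p n c, c \in fc_fil p n -> fc_diff (fc_diff c) = 0
}.

(* Homological convention: total degree p + q, d^r of bidegree (-r, r - 1),
     Z^r_{p,q} = {c in F_p C_{p+q} | d c in F_{p-r}},
     B^r_{p,q} = Z^{r-1}_{p-1,q+1} + d Z^{r-1}_{p+r-1,q-r+2},
     E^r_{p,q} = Z^r_{p,q} / B^r_{p,q}.
   The index r is an integer because r - 1 = -1 occurs for r = 0, where the
   formula gives E^0_{p,q} = F_p C_{p+q} / F_{p-1} C_{p+q}. *)
Section SpectralSequence.
Context (R : comNzRingType) (C : filteredComplex R).
Local Notation d := (fc_diff C).
Local Notation F := (fc_fil C).

Definition ss_Z (r p q : int) : {pred fc_sort C} :=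
  [pred c | (c \in F p (p + q)) && (d c \in F (p - r) (p + q - 1))].

Fact ss_Z_closed r p q : submod_closed (ss_Z r p q).
Proof.
split=> [|a x y]; rewrite !inE; first by rewrite linear0 !rpred0.
move=> /andP[Fx Fdx] /andP[Fy Fdy].
by rewrite linearP !rpredD // rpredZ.
Qed.
HB.instance Definition _ r p q :=
  GRing.isSubmodClosed.Build R (fc_sort C) (ss_Z r p q) (ss_Z_closed r p q).

Definition ss_B (r p q : int) : {pred fc_sort C} :=
  [pred c | `[< exists a b : fc_sort C,
    [/\ a \in ss_Z (r - 1) (p - 1) (q + 1),
        b \in ss_Z (r - 1) (p + r - 1) (q - r + 2) & c = a + d b] >]].

Fact ss_B_closed r p q : submod_closed (ss_B r p q).
Proof.
split=> [|k x y]; rewrite !inE.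
  by apply/asboolP; exists 0, 0; rewrite linear0 addr0 !rpred0.
move=> /asboolP[a [b [Za Zb ->]]] /asboolP[a' [b' [Za' Zb' ->]]].
apply/asboolP; exists (k *: a + a'), (k *: b + b').
by rewrite !rpredD ?rpredZ // linearP scalerDr addrACA.
Qed.
HB.instance Definition _ r p q :=
  GRing.isSubmodClosed.Build R (fc_sort C) (ss_B r p q) (ss_B_closed r p q).

Definition ss_page (r : nat) (p q : int) : lmodType R :=
  subquot (ss_Z r p q) (ss_B r p q).

Definition ss_class (r : nat) (p q : int) :
    submodule (ss_Z r p q) -> ss_page r p q :=
  @subquot_class _ _ (ss_Z r p q) (ss_B r p q).

Lemma ss_B_sub_Z r p q : {subset ss_B r p q <= ss_Z r p q}.
Proof.
move=> _ /asboolP[a [b [/andP[Fa Fda] /andP[Fb Fdb] ->]]].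
move: Fa Fda Fb Fdb.
have -> : p - 1 + (q + 1) = p + q by lia.
have -> : p - 1 - (r - 1) = p - r by lia.
have -> : p + r - 1 + (q - r + 2) - 1 = p + q by lia.
have -> : p + r - 1 - (r - 1) = p by lia.
move=> Fa Fda Fb Fdb; apply/andP; split.
  by rewrite rpredD // (fc_fil_mono _ Fa) //; lia.
by rewrite linearD /= (fc_diffK Fb) addr0.
Qed.

Fact ss_diff_rep_subproof (r : nat) p q (z : submodule (ss_Z r p q)) :
  d (val z) \in ss_Z r (p - r%:Z) (q + r%:Z - 1).
Proof.
have /andP[Fz Fdz] := valP z; apply/andP; split.
  by have -> : p - r%:Z + (q + r%:Z - 1) = p + q - 1 by lia.
by rewrite (fc_diffK Fz) rpred0.
Qed.

Definition ss_diff_rep (r : nat) p q (z : submodule (ss_Z r p q)) :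
    submodule (ss_Z r (p - r%:Z) (q + r%:Z - 1)) :=
  exist _ (d (val z)) (ss_diff_rep_subproof z).

Definition ss_diff (r : nat) p q (e : ss_page r p q) :
    ss_page r (p - r%:Z) (q + r%:Z - 1) :=
  ss_class (ss_diff_rep (repr (e : lquot _))).

Lemma ss_diff_class (r : nat) p q (z : submodule (ss_Z r p q)) :
  ss_diff (ss_class z) = ss_class (ss_diff_rep z).
Proof.
apply/subquot_classP => /=; rewrite -linearB.
have : val (repr (ss_class z : lquot _)) - val z \in ss_B r p q.
  by apply/(@subquot_classP _ _ _ (ss_B r p q)); rewrite /subquot_class reprK.
move: (_ - _) => c /asboolP[a [b [Za /andP[Fb _] ->]]].
apply/asboolP; exists 0, a; split; first exact: rpred0.
  have -> : p - r%:Z + r%:Z - 1 = p - 1 by lia.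
  by have -> : q + r%:Z - 1 - r%:Z + 2 = q + 1 by lia.
by rewrite linearD /= (fc_diffK Fb) addr0 add0r.
Qed.

Lemma ss_diff_linear (r : nat) p q : linear (@ss_diff r p q).
Proof.
move=> a e e'; have [z ->] := subquot_classE e.
have [z' ->] := subquot_classE e'.
rewrite -[a *: _ + _]subquot_class_linear !ss_diff_class.
rewrite /ss_class -subquot_class_linear; congr subquot_class.
by apply: val_inj; rewrite /= linearP.
Qed.
HB.instance Definition _ r p q :=
  GRing.isLinear.Build R (ss_page r p q) _ _ (@ss_diff r p q)
    (@ss_diff_linear r p q).

(* E^r = E^{r+1}: the differential d^r vanishes, and the resulting canonical
   identification of E^r with E^{r+1} = H(E^r, d^r), sending the r-class of a
   chain in Z^{r+1} to its (r+1)-class, is an isomorphism in every bidegree. *)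
Definition ss_page_eq_next (r : nat) : Prop :=
  forall p q : int,
    (forall e : ss_page r p q, ss_diff e = 0) /\
    (exists2 phi : {linear ss_page r p q -> ss_page r.+1 p q},
       bijective phi &
       forall (z : submodule (ss_Z r p q)) (z' : submodule (ss_Z r.+1 p q)),
         val z = val z' -> phi (ss_class z) = ss_class z').

End SpectralSequence.

Definition free_rank1 (R : comNzRingType) (M : lmodType R) : Prop :=
  exists phi : {linear R^o -> M}, bijective phi.

Definition zero_module (R : comNzRingType) (M : lmodType R) : Prop :=
  forall x : M, x = 0.

Definition rank1_exactly_in (R : comNzRingType) (E : int -> int -> lmodType R)
    (S : seq (int * int)) : Prop :=
  forall i j : int,
    if (i, j) \in S then free_rank1 (E i j) else zero_module (E i j).

Record digraph := Digraph { vertex :> choiceType; edge : rel vertex }.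

Section Distance.
Context (G : digraph).

Definition walk_of_length (x y : G) (n : nat) : bool :=
  `[< exists p : seq G, [/\ path (@edge G) x p, last x p = y & size p = n] >].

(* [None] stands for infinite distance. *)
Definition dist (x y : G) : option nat :=
  if pselect (exists n, walk_of_length x y n) is left xy_walk
  then Some (ex_minn xy_walk) else None.

Definition reach (x y : G) : bool := dist x y != None.

(* Meaningful when consecutive entries are at finite distance. *)
Definition tuple_length (s : seq G) : nat :=
  (\sum_(xy <- zip s (behead s)) odflt 0%N (dist xy.1 xy.2))%N.

Lemma reachP x y : reflect (exists n, walk_of_length x y n) (reach x y).
Proof. by rewrite /reach /dist; case: pselect => h /=; constructor. Qed.

Lemma dist_min x y n :
  walk_of_length x y n -> (odflt 0%N (dist x y) <= n)%N.
Proof.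
rewrite /dist; case: pselect => //= h w.
by case: ex_minnP => k _; apply.
Qed.

Lemma dist_walk x y : reach x y -> walk_of_length x y (odflt 0%N (dist x y)).
Proof.
rewrite /reach /dist; case: pselect => //= h _.
by case: ex_minnP.
Qed.

Lemma walk_cat x y z k l :
  walk_of_length x y k -> walk_of_length y z l -> walk_of_length x z (k + l)%N.
Proof.
move=> /asboolP[p [ep lp <-]] /asboolP[p' [ep' lp' <-]].
apply/asboolP; exists (p ++ p'); rewrite cat_path ep lp ep' last_cat lp size_cat.
by split.
Qed.

Lemma reach_trans : transitive reach.
Proof.
move=> y x z /dist_walk wxy /dist_walk wyz.
apply/reachP; exists (odflt 0%N (dist x y) + odflt 0%N (dist y z))%N.
exact: walk_cat wxy wyz.
Qed.

Lemma dist_triangle x y z : reach x y -> reach y z ->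
  (odflt 0 (dist x z) <= odflt 0 (dist x y) + odflt 0 (dist y z))%N.
Proof. by move=> /dist_walk wxy /dist_walk wyz; exact: dist_min (walk_cat wxy wyz). Qed.

Definition face (i : nat) (s : seq G) : seq G := take i s ++ drop i.+1 s.

Lemma face_subseq i s : subseq (face i s) s.
Proof.
elim: s i => [|x s IH] [|i] //; first by rewrite /face take0 /= drop0; apply: subseq_cons.
by rewrite /face /= eqxx; apply: IH.
Qed.

Lemma size_face i s : (i < size s)%N -> (size (face i s)).+1 = size s.
Proof. by move=> lt_is; rewrite size_cat size_takel ?size_drop; lia. Qed.

Lemma tuple_length_face i s :
  sorted reach s -> (tuple_length (face i s) <= tuple_length s)%N.
Proof.
elim: s i => [|x s IH] i; first by rewrite /face.
case: i => [|i].
  rewrite /face /= drop0 /tuple_length /=.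
  by case: s {IH} => [|y s] _ /=; rewrite ?big_nil // big_cons leq_addl.
case: s IH => [|y s] IH; first by rewrite /face.
move=> /= /andP[rxy rs].
have := IH i rs; rewrite /face /=.
case: i => [|i] /=.
  rewrite !drop0 => _; case: s {IH} rs => [|z s] /=.
    by rewrite /tuple_length /= big_nil.
  move=> /andP[ryz _]; rewrite /tuple_length /= !big_cons /= addnA.
  by rewrite leq_add2r dist_triangle.
by rewrite /tuple_length /= !big_cons /= => h; rewrite leq_add2l.
Qed.

End Distance.

Section ReachabilityComplex.
Context (R : comNzRingType) (G : digraph).

(* Chains of all degrees live in the free module on all finite sequences of
   vertices; RC_k(G) is the submodule spanned by the [rc_tuple]s of size k+1. *)
Local Notation chains := {malg R[seq G]}.

Definition nonrepeating (s : seq G) : bool :=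
  (s != [::]) && sorted [rel x y | x != y] s.

Definition rc_tuple (s : seq G) : bool :=
  (s != [::]) && sorted [rel x y | (x != y) && reach x y] s.

Definition rc_fil (p n : int) : {pred chains} :=
  [pred c : chains |
    `[< forall s, s \in msupp c ->
        [/\ rc_tuple s, (size s)%:Z = n + 1 & (tuple_length s)%:Z <= p] >]].

(* A face of a 1-tuple is empty, hence omitted: the boundary is 0 in degree 0. *)
Definition rc_boundary_tuple (s : seq G) : chains :=
  \sum_(i < size s | nonrepeating (face i s)) (-1) ^+ i *: << face i s >>.

Definition lin_ext (f : seq G -> chains) (c : chains) : chains :=
  \sum_(s <- msupp c) c@_s *: f s.

Definition rc_boundary : chains -> chains := lin_ext rc_boundary_tuple.

Lemma lin_extEw f (c : chains) (D : {fset seq G}) :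
  (msupp c `<=` D)%fset -> lin_ext f c = \sum_(s <- D) c@_s *: f s.
Proof.
move=> sub; rewrite /lin_ext; apply: big_fset_incl => // s _ /mcoeff_outdom ->.
by rewrite scale0r.
Qed.

Lemma lin_ext_linear f : linear (lin_ext f).
Proof.
move=> a x y; pose D := (msupp x `|` msupp y `|` msupp (a *: x + y))%fset.
rewrite !(@lin_extEw _ _ D) ?fsubsetUr //; first last.
- exact/(fsubset_trans (fsubsetUl _ (msupp y)))/fsubsetUl.
- exact/(fsubset_trans (fsubsetUr (msupp x) _))/fsubsetUl.
rewrite scaler_sumr -big_split; apply: eq_bigr => s _ /=.
by rewrite mcoeffD mcoeffZ scalerDl scalerA.
Qed.
HB.instance Definition _ f :=
  GRing.isLinear.Build R chains chains _ (lin_ext f) (lin_ext_linear f).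
HB.instance Definition _ := GRing.Linear.on rc_boundary.

Lemma lin_extU f s : lin_ext f << s >> = f s.
Proof.
rewrite (@lin_extEw _ _ [fset s]%fset) ?msuppU_le //.
by rewrite big_seq_fset1 mcoeffUU scale1r.
Qed.

Lemma chainE (c : chains) : c = \sum_(s <- msupp c) c@_s *: << s >>.
Proof.
rewrite {1}[c]monalgE; apply: eq_bigr => s _; apply/malgP => t.
by rewrite mcoeffZ !mcoeffU mulr_natr.
Qed.

Lemma chain_ind (P : chains -> Prop) :
  P 0 -> (forall a x y, P x -> P y -> P (a *: x + y)) ->
  (forall s, P << s >>) -> forall c, P c.
Proof.
move=> P0 PD PU c; rewrite [c]chainE; elim/big_rec: _ => // s x _ Px.
exact: PD.
Qed.

Definition full_boundary (s : seq G) : chains :=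
  \sum_(i < size s) (-1) ^+ i *: << face i s >>.
Definition cons_chain (x : G) : chains -> chains :=
  lin_ext (fun s => << x :: s >>).
HB.instance Definition _ x := GRing.Linear.on (cons_chain x).
Definition drop_repeating : chains -> chains :=
  lin_ext (fun s => if nonrepeating s then << s >> else 0).
HB.instance Definition _ := GRing.Linear.on drop_repeating.

Lemma full_boundary_cons x s :
  full_boundary (x :: s) = << s >> - cons_chain x (full_boundary s).
Proof.
rewrite /full_boundary big_ord_recl /= expr0 scale1r /face /= drop0.
congr (_ + _); rewrite (linear_sum (cons_chain x)) /= -sumrN; apply: eq_bigr => i _ /=.
by rewrite linearZ /= /cons_chain lin_extU exprS mulN1r scaleNr.
Qed.

Lemma full_boundary_cons_chain x (c : chains) :
  lin_ext full_boundary (cons_chain x c)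
    = c - cons_chain x (lin_ext full_boundary c).
Proof.
elim/chain_ind: c => [|a y z IHy IHz|s]; first by rewrite !linear0 addr0.
  by rewrite !linearP /= IHy IHz scalerBr scalerN addrACA.
by rewrite /cons_chain !lin_extU; exact: full_boundary_cons.
Qed.

Lemma full_boundaryK s : lin_ext full_boundary (full_boundary s) = 0.
Proof.
elim: s => [|x s IH]; first by rewrite /full_boundary big_ord0 linear0.
rewrite full_boundary_cons linearB /= full_boundary_cons_chain IH linear0 subr0.
by rewrite lin_extU subrr.
Qed.

Lemma rc_boundary_tupleE s :
  rc_boundary_tuple s = drop_repeating (full_boundary s).
Proof.
rewrite /full_boundary linear_sum /rc_boundary_tuple big_mkcond.
apply: eq_bigr => i _ /=; rewrite linearZ /= /drop_repeating lin_extU.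
by case: ifP; rewrite ?scaler0.
Qed.

Lemma rc_boundaryE (c : chains) :
  rc_boundary c = drop_repeating (lin_ext full_boundary c).
Proof.
elim/chain_ind: c => [|a x y IHx IHy|s]; first by rewrite !linear0.
  by rewrite !linearP /= IHx IHy.
by rewrite /rc_boundary !lin_extU rc_boundary_tupleE.
Qed.

Lemma repeatingP s : s != [::] -> ~~ nonrepeating s ->
  exists a x b, s = a ++ x :: x :: b.
Proof.
rewrite /nonrepeating => -> /=; case: s => // y s /=.
elim: s y => //= z s IH y; rewrite negb_and negbK.
case/orP=> [/eqP<-|/IH[a [x [b e]]]]; first by exists [::], y, s.
by exists (y :: a), x, b; rewrite e.
Qed.

Lemma repeating_cat a x b : nonrepeating (a ++ x :: x :: b) = false.
Proof.
rewrite /nonrepeating; apply/negP => /andP[_ /cat_sorted2[_]].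
by rewrite /= eqxx.
Qed.

Lemma rc_boundary_repeating s : ~~ nonrepeating s -> rc_boundary_tuple s = 0.
Proof.
have [->|s0] := eqVneq s [::]; first by rewrite /rc_boundary_tuple big_ord0.
move=> /(repeatingP s0)[a [x [b ->]]]; set t := _ ++ _.
have szt : size t = (size a + (size b).+2)%N by rewrite size_cat.
have lt0 : (size a < size t)%N by lia.
have lt1 : ((size a).+1 < size t)%N by lia.
have f0 : face (size a) t = a ++ x :: b.
  by rewrite /face take_size_cat // drop_cat ltnNge leqnSn /= subSnn.
have f1 : face (size a).+1 t = a ++ x :: b.
  rewrite /face take_cat drop_cat !ltnNge !leqW //= subSnn -addn2 addKn /=.
  by rewrite drop0 -catA.
rewrite /rc_boundary_tuple big_mkcond (bigD1 (Ordinal lt0)) //=.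
rewrite (bigD1 (Ordinal lt1)) /=; last by rewrite -val_eqE /=; lia.
rewrite big1 ?addr0 => [|i /andP[]].
  rewrite f0 f1; case: ifP => _; rewrite ?addr0 // exprS mulN1r scaleNr.
  exact: subrr.
rewrite -!val_eqE /= => n0 n1.
suff -> : nonrepeating (face i t) = false by [].
have := ltn_ord i; rewrite /face.
have [lt|ge] := ltnP i (size a).
  move=> _; rewrite /t take_cat lt drop_cat.
  case: ltnP => [_|ge]; first by rewrite catA repeating_cat.
  have -> : (i.+1 - size a = 0)%N by lia.
  by rewrite drop0 repeating_cat.
have [k ->] : exists k, nat_of_ord i = (size a + k.+2)%N.
  exists (i - (size a).+2)%N; have {}n0 : nat_of_ord i <> size a by exact/eqP.
  have {}n1 : nat_of_ord i <> (size a).+1 by exact/eqP.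
  by lia.
have e1 : (size a + k.+2 < size a)%N = false by lia.
have e2 : ((size a + k.+2).+1 < size a)%N = false by lia.
move=> _; rewrite /t take_cat drop_cat e1 e2.
rewrite -addnS !addKn /= -catA /=.
exact: repeating_cat.
Qed.

Lemma rc_boundary_drop (c : chains) :
  rc_boundary (drop_repeating c) = rc_boundary c.
Proof.
elim/chain_ind: c => [|a x y IHx IHy|s]; first by rewrite !linear0.
  by rewrite !linearP /= IHx IHy.
rewrite /drop_repeating lin_extU; case: ifP => // /negbT ns.
by rewrite linear0 /rc_boundary lin_extU rc_boundary_repeating.
Qed.

Lemma rc_boundaryK (c : chains) : rc_boundary (rc_boundary c) = 0.
Proof.
rewrite [rc_boundary c]rc_boundaryE rc_boundary_drop rc_boundaryE.
elim/chain_ind: c => [|a x y IHx IHy|s]; first by rewrite !linear0.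
  by rewrite !linearP /= IHx IHy scaler0 addr0.
by rewrite lin_extU full_boundaryK linear0.
Qed.

Fact rc_fil_closed p n : submod_closed (rc_fil p n).
Proof.
split=> [|a x y]; rewrite !inE.
  by apply/asboolP => s; rewrite msupp0 in_fset0.
move=> /asboolP Fx /asboolP Fy; apply/asboolP => s.
move=> /(fsubsetP (msuppD_le _ _)); rewrite in_fsetU.
by case/orP=> [/(fsubsetP (msuppZ_le _ _))/Fx|/Fy].
Qed.
HB.instance Definition _ p n :=
  GRing.isSubmodClosed.Build R chains (rc_fil p n) (rc_fil_closed p n).

Fact rc_fil_mono p p' n : p <= p' -> {subset rc_fil p n <= rc_fil p' n}.
Proof.
move=> le_pp' c /asboolP Fc; apply/asboolP => s /Fc[ts ss ls].
by split=> //; apply: le_trans le_pp'.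
Qed.

Lemma rc_filU p n s :
  rc_tuple s -> (size s)%:Z = n + 1 -> (tuple_length s)%:Z <= p ->
  << s >> \in rc_fil p n.
Proof.
move=> ts ss ls; apply/asboolP => t /(fsubsetP msuppU_le).
by rewrite in_fset1 => /eqP ->.
Qed.

Fact rc_boundary_fil p n c :
  c \in rc_fil p n -> rc_boundary c \in rc_fil p (n - 1).
Proof.
move=> /asboolP Fc; rewrite /rc_boundary /lin_ext big_seq rpred_sum // => s sc.
have [/andP[s0 srt] ss ls] := Fc _ sc.
have rs : sorted (@reach G) s.
  by apply: sub_sorted srt => x y /= /andP[].
rewrite rpredZ // rpred_sum // => i nr; rewrite rpredZ // rc_filU //.
- have /andP[f0 fs] := nr; rewrite /rc_tuple f0 /=.
  have : sorted (@reach G) (face i s).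
    exact: subseq_sorted (@reach_trans G) _ _ (face_subseq _ _) rs.
  move: fs; case: (face i s) => //= x t.
  elim: t x => //= y t IH x /andP[-> /IH h] /andP[-> /h ->].
  by [].
- by have := size_face (ltn_ord i); lia.
- by apply: le_trans ls; rewrite lez_nat tuple_length_face.
Qed.

Definition reachability_complex : filteredComplex R :=
  @FilteredComplex R chains rc_boundary rc_fil rc_fil_mono rc_boundary_fil
    (fun _ _ c _ => rc_boundaryK c).

Definition mpss_page : nat -> int -> int -> lmodType R :=
  ss_page reachability_complex.

Definition path_homology (k l : int) : lmodType R := mpss_page 2 l (k - l).

End ReachabilityComplex.

(* Vertices 0, 1, ..., m form the interval with m edges; the interval with n
   edges runs 0, m+1, ..., m+n-1, m, its j-th vertex being [second_arc m n j],
   so that both intervals start at 0 and end at m.  For m = n = 1 the two edges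
   0 -> m coincide, as there are no parallel edges. *)
Definition second_arc (m n j : nat) : nat :=
  if j == 0%N then 0%N else if j == n then m else (m + j)%N.

Definition bicycle_edge (m n : nat) : rel 'I_(m + n) := fun u v =>
  [exists i : 'I_m, (u == i :> nat) && (v == i.+1 :> nat)] ||
  [exists j : 'I_n,
    (u == second_arc m n j :> nat) && (v == second_arc m n j.+1 :> nat)].

Definition bicycle (m n : nat) : digraph := Digraph (@bicycle_edge m n).

(* Main.v *)
(** Write a for the source, b for the sink, and P(x, y) for the sum of the edges of
  a chosen shortest path from x to y, the shorter arc being chosen for (a, b).
  Put h(x_0) = P(x_0, b) and h(x_0, ..., x_k) = P(x_0, x_1).(x_1, ..., x_k), where
  the dot is concatenation.  If P were additive along x -> y -> z, then id + dh + hd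
  would send every vertex to b and every longer tuple to 0.  Additivity fails only
  for (x, y, z) = (a, y, b) with y inside the longer arc, the defect being the loop
  g = P(longer arc) - P(shorter arc).  So id + dh + hd takes values in the span of b,
  of g (filtration 1) and of s = g.b (filtration max(m, n)), where ds = g.  As h
  raises the filtration by at most 1, this map is the identity on E^r for r >= 2,
  so these pages are those of the small complex spanned by b, g and s. *)
From HB Require Import structures.
Require Import Defs.
From mathcomp Require Import all_boot all_order all_algebra.
From mathcomp Require Import finmap boolp monalg zify.

Set Implicit Arguments.
Unset Strict Implicit.
Unset Printing Implicit Defensive.

Import Order.TTheory GRing.Theory Num.Theory.

Local Open Scope ring_scope.

(** * Preliminaries on submodules and linear maps *)

Lemma submodB (R : comNzRingType) (V : lmodType R) (Z : submodClosed V) (x y : V) :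
  x \in Z -> y \in Z -> x - y \in Z.
Proof. by move=> Zx Zy; rewrite -scaleN1r rpredD ?rpredZ. Qed.

Lemma linear_bundle (R : comNzRingType) (U V : lmodType R) (f : U -> V) :
  linear f -> exists phi : {linear U -> V}, phi =1 f.
Proof.
move=> lin_f.
exists (HB.pack_for {linear U -> V} f (GRing.isLinear.Build R U V _ f lin_f)).
by [].
Qed.

Section Multiples.
Context (R : comNzRingType) (V : lmodType R) (x : V).

Definition multiples (a : R^o) : V := a *: x.

Fact multiples_linear : linear multiples.
Proof. by move=> a b c; rewrite /multiples scalerDl scalerA. Qed.
HB.instance Definition _ :=
  GRing.isLinear.Build R R^o V _ multiples multiples_linear.

End Multiples.

(** * Pages of a filtered complex that contracts onto a three-generator complex *)

Section PageComputation.
Context (R : comNzRingType) (C : filteredComplex R).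
Local Notation d := (fc_diff C).
Local Notation F := (fc_fil C).

Context (h : {linear fc_sort C -> fc_sort C}).
Context (e0 e1 e2 : {scalar fc_sort C}) (v g s : fc_sort C) (M : int).

(** The projection onto the span of [v], [g] and [s], with [e0], [e1], [e2] as coordinates;
    [h_homotopy] makes it chain homotopic to the identity. *)
Definition reduction c : fc_sort C := e0 c *: v + e1 c *: g + e2 c *: s.

(* The loop [g] vanishes when [M <= 1], hence the disjuncts [M <= 1]. *)
Context
  (h_fil : forall p n c, c \in F p n -> h c \in F (p + 1) (n + 1))
  (h_homotopy : forall p n c, c \in F p n ->
     c + d (h c) + h (d c) = reduction c)
  (e0_eq0 : forall p n c, c \in F p n -> (n != 0) || (p < 0) -> e0 c = 0)
  (e1_eq0 : forall p n c, c \in F p n -> [|| n != 1, p < 1 | M <= 1] -> e1 c = 0)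
  (e2_eq0 : forall p n c, c \in F p n -> [|| n != 2, p < M | M <= 1] -> e2 c = 0)
  (v_fil : v \in F 0 0) (g_fil : g \in F 1 1) (s_fil : s \in F M 2)
  (dv : d v = 0) (dg : d g = 0) (ds : d s = g)
  (e0v : e0 v = 1) (e1g : 1 < M -> e1 g = 1).

Lemma fil_cast p n p' n' c : c \in F p n -> p <= p' -> n = n' -> c \in F p' n'.
Proof. by move=> Fc le_pp' <-; apply: fc_fil_mono Fc. Qed.

Lemma reduction_fil p n c : c \in F p n -> reduction c \in F p n.
Proof.
move=> Fc; rewrite /reduction !rpredD //.
- have [/(e0_eq0 Fc)->|] := boolP ((n != 0) || (p < 0)); first by rewrite scale0r rpred0.
  by move=> ?; rewrite rpredZ // (fil_cast v_fil) //; lia.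
- have [/(e1_eq0 Fc)->|] := boolP ([|| n != 1, p < 1 | M <= 1]); first by rewrite scale0r rpred0.
  by move=> ?; rewrite rpredZ // (fil_cast g_fil) //; lia.
- have [/(e2_eq0 Fc)->|] := boolP ([|| n != 2, p < M | M <= 1]); first by rewrite scale0r rpred0.
  by move=> ?; rewrite rpredZ // (fil_cast s_fil) //; lia.
Qed.

Lemma d_reduction c : d (reduction c) = e2 c *: g.
Proof. by rewrite /reduction !linearD !linearZ /= dv dg ds !scaler0 !add0r. Qed.

(** By the homotopy formula and [d d = 0], both [reduction (d c)] and [d (reduction c)] equal
    [d c + d (h (d c))]. *)
Lemma reduction_d p n c : c \in F p n -> reduction (d c) = e2 c *: g.
Proof.
move=> Fc; rewrite -d_reduction -(h_homotopy Fc) -(h_homotopy (fc_diff_fil Fc)).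
have ddc := fc_diffK Fc.
rewrite !linearD /= ddc linear0 addr0; congr (_ + _).
by rewrite (fc_diffK (h_fil Fc)) addr0.
Qed.

(** In degree 1 only the [v] term of [reduction_d] survives, and applying [e0] isolates its
    coefficient since [e0 v = 1]. The same device with [e1] gives [e1_d]. *)
Lemma e0_d p n c : c \in F p n -> e0 (d c) = 0.
Proof.
move=> Fc; have Fdc := fc_diff_fil Fc.
have [n1|n1] := eqVneq n 1; last by rewrite (e0_eq0 Fdc) //; lia.
have := reduction_d Fc.
rewrite /reduction (e1_eq0 Fdc) ?(e2_eq0 Fdc) ?(e2_eq0 Fc) ?scale0r ?addr0; try lia.
by move/(congr1 e0); rewrite linearZ /= e0v linear0 mulr1.
Qed.

Lemma e1_d p n c : c \in F p n -> e1 (d c) = e2 c.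
Proof.
move=> Fc; have Fdc := fc_diff_fil Fc.
have [M1|M1] := leP M 1; first by rewrite (e1_eq0 Fdc) ?(e2_eq0 Fc) //; lia.
have [n2|n2] := eqVneq n 2; last by rewrite (e1_eq0 Fdc) ?(e2_eq0 Fc) //; lia.
have := reduction_d Fc.
rewrite /reduction (e0_eq0 Fdc) ?(e2_eq0 Fdc) ?scale0r ?addr0 ?add0r; try lia.
by move/(congr1 e1); rewrite !linearZ /= (e1g M1) !mulr1.
Qed.

Lemma e2_d p n c : c \in F p n -> e2 (d c) = 0.
Proof.
by move=> Fc; rewrite -(e1_d (fc_diff_fil Fc)) (fc_diffK Fc) linear0.
Qed.

Lemma e2s : 1 < M -> e2 s = 1.
Proof. by move=> M1; rewrite -(e1_d s_fil) ds e1g. Qed.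

(* The coordinate of [c] on the generator of E^r in bidegree [(p, q)]. *)
Definition page_coef (r p q : int) (c : fc_sort C) : R :=
  if (p == 0) && (q == 0) then e0 c
  else if [&& r < M, p == 1 & q == 0] then e1 c
  else if [&& r < M, p == M & q == 2 - M] then e2 c
  else 0.

Lemma page_coef0 r p q c : p = 0 -> q = 0 -> page_coef r p q c = e0 c.
Proof. by move=> -> ->. Qed.

Lemma page_coef1 r p q c : r < M -> p = 1 -> q = 0 -> page_coef r p q c = e1 c.
Proof. by rewrite /page_coef => -> -> ->. Qed.

Lemma page_coef2 r p q c : 2 <= r -> r < M -> p = M -> q = 2 - M ->
  page_coef r p q c = e2 c.
Proof.
move=> r2 rM -> ->; rewrite /page_coef rM !eqxx.
have -> : (M == 0) = false by lia.
by have -> : (M == 1) = false by lia.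
Qed.

Lemma page_coef_linear r p q : scalar (page_coef r p q).
Proof.
move=> a x y; rewrite /page_coef.
by do 3![case: ifP => _; first by rewrite linearP]; rewrite mulr0 addr0.
Qed.
HB.instance Definition _ r p q :=
  GRing.isLinear.Build R (fc_sort C) R _ (page_coef r p q) (page_coef_linear r p q).

(** For [M > 1] the coordinates are dual to the generators: the mixed values such as [e0 g] vanish
    for degree reasons. *)
Lemma page_coef_reduction r p q c : 2 <= r ->
  c \in F p (p + q) -> page_coef r p q (reduction c) = page_coef r p q c.
Proof.
move=> r2 Fc; rewrite /page_coef /reduction.
have e0g : e0 g = 0 by rewrite (e0_eq0 g_fil).
have e0s : e0 s = 0 by rewrite (e0_eq0 s_fil).
have e1v : e1 v = 0 by rewrite (e1_eq0 v_fil).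
have e1s : e1 s = 0 by rewrite (e1_eq0 s_fil).
have e2v : e2 v = 0 by rewrite (e2_eq0 v_fil).
have e2g : e2 g = 0 by rewrite (e2_eq0 g_fil).
case: ifP => [_|_].
  by rewrite !linearD !linearZ /= e0v e0g e0s !mulr0 mulr1 !addr0.
case: ifP => [/andP[rM _]|_].
  by rewrite !linearD !linearZ /= e1v e1g ?e1s ?mulr0 ?mulr1 ?addr0 ?add0r //; lia.
case: ifP => [/andP[rM _]|//].
by rewrite !linearD !linearZ /= e2v e2g e2s ?mulr0 ?mulr1 ?addr0 ?add0r //; lia.
Qed.

Lemma ss_ZP r p q c :
  (c \in ss_Z (C := C) r p q) = (c \in F p (p + q)) && (d c \in F (p - r) (p + q - 1)).
Proof. by []. Qed.

(** Such a chain lies in the summand Z^{r-1}_{p-1,q+1} of B^r_{p,q}, whose condition on the boundary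
    is that of Z^r_{p,q} because (p - 1) - (r - 1) = p - r. *)
Lemma cycle_in_B r p q c k n :
  c \in F k n -> n = p + q -> k < p -> d c \in F (p - r) (n - 1) -> c \in ss_B (C := C) r p q.
Proof.
move=> Fc en kp Fdc; apply/asboolP; exists c, 0; rewrite rpred0 linear0 addr0; split=> //.
rewrite ss_ZP; apply/andP; split; first by apply: (fil_cast Fc); lia.
by apply: (fil_cast Fdc); lia.
Qed.

(* [reduction c - c = d (h c) + h (d c)]; for [r >= 2] the first term is a
   boundary from filtration [p + 1 <= p + r - 1] and the second has filtration
   [p - r + 1 <= p - 1]. *)
Lemma sub_reduction_in_B r p q c : 2 <= r -> c \in ss_Z (C := C) r p q ->
  reduction c - c \in ss_B (C := C) r p q.
Proof.
move=> r2 /andP[Fc Fdc].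
have Fhdc := h_fil Fdc; have Fhc := h_fil Fc.
have e := h_homotopy Fc; have e' := h_homotopy Fdc.
rewrite (fc_diffK Fc) linear0 addr0 in e'.
apply/asboolP; exists (h (d c)), (h c); split.
- rewrite ss_ZP; apply/andP; split; first by apply: (fil_cast Fhdc); lia.
  have -> : d (h (d c)) = reduction (d c) - d c by rewrite -e' addrAC subrr add0r.
  by apply: submodB; [apply: (fil_cast (reduction_fil Fdc))|apply: (fil_cast Fdc)]; lia.
- rewrite ss_ZP; apply/andP; split; first by apply: (fil_cast Fhc); lia.
  have -> : d (h c) = reduction c - c - h (d c).
    by rewrite -e [RHS]addrAC addrK addrC addKr.
  have Frc := reduction_fil Fc.
  apply: submodB; [apply: submodB|].
  - by apply: (fil_cast (reduction_fil Fc)); lia.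
  - by apply: (fil_cast Fc); lia.
  - by apply: (fil_cast Fhdc); lia.
- by rewrite -e [LHS]addrC -addrA addKr addrC.
Qed.

(** In [a + d b], the chain [a] has filtration below that of the generator. Of the coordinates of
    [d b] only [e1 (d b) = e2 b] can survive, but there [p = 1], so [b] has filtration at most
    [r < M]. *)
Lemma ss_B_coef r p q c : 2 <= r -> c \in ss_B (C := C) r p q -> page_coef r p q c = 0.
Proof.
move=> r2 /asboolP[a [b [/andP[Fa _] /andP[Fb _] ->]]].
rewrite /page_coef; case: ifP => [/andP[/eqP p0 /eqP q0]|_].
  by rewrite linearD /= (e0_d Fb) (e0_eq0 Fa) ?addr0 //; lia.
case: ifP => [/and3P[rM /eqP p0 /eqP q0]|_].
  by rewrite linearD /= (e1_d Fb) (e1_eq0 Fa) ?(e2_eq0 Fb) ?addr0 //; lia.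
case: ifP => [/and3P[rM /eqP p0 /eqP q0]|//].
by rewrite linearD /= (e2_d Fb) (e2_eq0 Fa) ?addr0 //; lia.
Qed.

Lemma reduction_in_B r p q c : 2 <= r -> c \in ss_Z (C := C) r p q ->
  page_coef r p q c = 0 -> reduction c \in ss_B (C := C) r p q.
Proof.
move=> r2 /andP[Fc Fdc] coef0; rewrite /reduction !rpredD //.
- have [/(e0_eq0 Fc)->|pq] := boolP ((p + q != 0) || (p < 0)).
    by rewrite scale0r rpred0.
  have [p0|p0] := eqVneq p 0.
    by move: coef0; rewrite page_coef0 => [->||]; rewrite ?scale0r ?rpred0 //; lia.
  by rewrite rpredZ // (cycle_in_B v_fil) ?dv ?rpred0 //; lia.
- have [/(e1_eq0 Fc)->|pq] := boolP [|| p + q != 1, p < 1 | M <= 1].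
    by rewrite scale0r rpred0.
  have [p1|p1] := eqVneq p 1; last first.
    by rewrite rpredZ // (cycle_in_B g_fil) ?dg ?rpred0 //; lia.
  have [rM|Mr] := ltP r M.
    by move: coef0; rewrite page_coef1 => [->|||]; rewrite ?scale0r ?rpred0 //; lia.
  (* From page [M] on, [g = d s] dies: with [p = 1], the filtration [M] of [s] is at most
     [p + r - 1 = r]. *)
  rewrite rpredZ //; apply/asboolP; exists 0, s; rewrite rpred0 ds add0r; split=> //.
  rewrite ss_ZP ds; apply/andP; split; first by apply: (fil_cast s_fil); lia.
  by apply: (fil_cast g_fil); lia.
- have [/(e2_eq0 Fc)->|pq] := boolP [|| p + q != 2, p < M | M <= 1].
    by rewrite scale0r rpred0.
  (* If [p - r < 1], then [d c] lies below the filtration of the loop, so [e2 c = e1 (d c)]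
     vanishes. Otherwise [g] has filtration at most [p - r], so either [p = M] and [e2 c] is the
     page coordinate, or [p > M] and [s] lies in B. *)
  have [pr1|pr1] := ltP (p - r) 1.
    by rewrite -(e1_d Fc) (e1_eq0 Fdc) ?scale0r ?rpred0 // pr1 orbT.
  have [pM|pM] := eqVneq p M.
    by move: coef0; rewrite page_coef2 => [->||||]; rewrite ?scale0r ?rpred0 //; lia.
  rewrite rpredZ // (cycle_in_B s_fil) //; try lia.
  by rewrite ds; apply: (fil_cast g_fil); lia.
Qed.

(** Modulo B a chain equals its reduction. Hence B is the kernel of [page_coef] on Z, and E^r embeds
    in R for [r >= 2]. *)
Lemma ss_BP r p q c : 2 <= r -> c \in ss_Z (C := C) r p q ->
  reflect (page_coef r p q c = 0) (c \in ss_B (C := C) r p q).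
Proof.
move=> r2 Zc; apply: (iffP idP) => [|coef0]; first exact: ss_B_coef.
have -> : c = reduction c - (reduction c - c) by rewrite opprB addrC subrK.
by rewrite submodB ?reduction_in_B ?sub_reduction_in_B.
Qed.

Lemma ss_classZ (r : nat) p q a (z : submodule (ss_Z (C := C) r p q)) :
  a *: ss_class z = ss_class (a *: z).
Proof. by rewrite /ss_class linearZ. Qed.

Lemma ss_class_surj (r : nat) p q (e : ss_page C r p q) : exists z, e = ss_class z.
Proof. exact: subquot_classE. Qed.

Lemma ss_class_eqP (r : nat) p q (x y : submodule (ss_Z (C := C) r p q)) : (2 <= r)%N ->
  ss_class x = ss_class y <-> page_coef r p q (val x) = page_coef r p q (val y).
Proof.
move=> r2; rewrite subquot_classP -[_ - _]/(val (x - y)).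
split=> [/(@ss_B_coef r%:Z p q _ r2)/eqP|e].
  by rewrite linearB /= subr_eq0 => /eqP.
by apply/ss_BP; rewrite ?(valP (x - y)) //= linearB /= e subrr.
Qed.

(** For [r >= 2] the chosen representative is immaterial, by [ss_coef_class]. *)
Definition ss_coef (r : nat) p q (e : ss_page C r p q) : R :=
  page_coef r p q (val (repr (e : lquot _))).

Lemma ss_coef_class (r : nat) p q (z : submodule (ss_Z (C := C) r p q)) :
  (2 <= r)%N -> ss_coef (ss_class z) = page_coef r p q (val z).
Proof. by move=> r2; apply/(ss_class_eqP _ _ r2); rewrite /ss_class /subquot_class reprK. Qed.

(** The isomorphism sends a scalar to that multiple of the class of [w]; [ss_coef] is its
    inverse. *)
Lemma ss_page_free_rank1 (r : nat) p q w : (2 <= r)%N ->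
  w \in ss_Z (C := C) r p q -> page_coef r p q w = 1 -> free_rank1 (ss_page C r p q).
Proof.
move=> r2 Zw w1; pose x : submodule (ss_Z (C := C) r p q) := exist _ w Zw.
have multE (a : R) : multiples (ss_class x) a = ss_class (a *: x) by exact: ss_classZ.
exists (multiples (ss_class x)), (@ss_coef r p q) => [a|e].
  by rewrite /= multE ss_coef_class //= linearZ /= w1 mulr1.
have [z ->] := ss_class_surj e; rewrite /= ss_coef_class // multE.
by apply/ss_class_eqP => //=; rewrite linearZ /= w1 mulr1.
Qed.

Lemma ss_page_zero (r : nat) p q : (2 <= r)%N ->
  (forall c, page_coef r p q c = 0) -> zero_module (ss_page C r p q).
Proof.
move=> r2 coef0 e; have [z ->] := subquot_classE e.
rewrite -(linear0 (@subquot_class _ _ (ss_Z r p q) (ss_B r p q))).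
by apply/subquot_classP; rewrite subr0; apply/ss_BP => //; apply: valP.
Qed.

Lemma ss_coef_inj (r : nat) p q : (2 <= r)%N -> injective (@ss_coef r p q).
Proof.
move=> r2 e e'; have [z ->] := ss_class_surj e; have [z' ->] := ss_class_surj e'.
by rewrite !ss_coef_class // => ?; apply/ss_class_eqP.
Qed.

Lemma ss_coefP (r : nat) p q a (e e' : ss_page C r p q) : (2 <= r)%N ->
  ss_coef (a *: e + e') = a * ss_coef e + ss_coef e'.
Proof.
move=> r2; have [z ->] := ss_class_surj e; have [z' ->] := ss_class_surj e'.
by rewrite /ss_class -linearP !ss_coef_class //= linearP.
Qed.

Lemma ss_coef0 (r : nat) p q : (2 <= r)%N -> ss_coef (0 : ss_page C r p q) = 0.
Proof.
move=> r2; have := ss_coefP 1 (0 : ss_page C r p q) 0 r2.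
by rewrite scaler0 addr0 mul1r => /eqP; rewrite -subr_eq subrr eq_sym => /eqP.
Qed.

(** Reducing a representative lifts it to the next page: its boundary becomes a multiple of [g], and
    where [e2 c] can be nonzero, [p >= M > r] leaves room for filtration 1 in [p - r]. *)
Lemma reduction_Z (r p q : int) c : r < M ->
  c \in ss_Z (C := C) (r - 1) p q -> reduction c \in ss_Z (C := C) r p q.
Proof.
move=> rM /andP[Fc Fdc]; rewrite ss_ZP reduction_fil //= d_reduction.
have [/(e2_eq0 Fc)->|pq] := boolP [|| p + q != 2, p < M | M <= 1].
  by rewrite scale0r rpred0.
by rewrite rpredZ // (fil_cast g_fil); lia.
Qed.

(** The only coordinate that could survive is [e1 (d z) = e2 z] with target filtration [p - r = 1];
    then [p = r + 1 < M] forces [e2 z = 0]. *)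
Lemma ss_diff_eq0 (r : nat) p q (e : ss_page C r p q) :
  (2 <= r)%N -> r%:Z < M - 1 -> ss_diff e = 0.
Proof.
move=> r2 rM; have [z ->] := ss_class_surj e.
have /andP[Fz Fdz] := valP z.
apply: (ss_coef_inj r2); rewrite ss_diff_class ss_coef_class //=.
rewrite ss_coef0 // /page_coef (e0_d Fz) (e1_d Fz) (e2_d Fz).
case: ifP => // _; case: ifP => [/and3P[_ /eqP p1 /eqP q0]|_]; last by case: ifP.
by rewrite (e2_eq0 Fz) //; lia.
Qed.

Lemma page_coefS r p q c : 2 <= r -> r < M - 1 ->
  page_coef (r + 1) p q c = page_coef r p q c.
Proof.
move=> r2 rM; rewrite /page_coef.
have -> : r + 1 < M by lia.
by have -> : r < M by lia.
Qed.

(** The map [up] reduces a representative so that it lies in Z^{r+1}, and [down] regards a chain of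
    Z^{r+1} as one of Z^r. Both preserve the coordinate, which is injective, so they are mutually
    inverse. *)
Lemma ss_page_eq_nextP (r : nat) :
  (2 <= r)%N -> r%:Z < M - 1 -> ss_page_eq_next C r.
Proof.
move=> r2 rM p q; split=> [e|]; first exact: ss_diff_eq0.
have coefS c : page_coef r.+1 p q c = page_coef r p q c.
  by rewrite -addn1 PoszD page_coefS.
have redZ (z : submodule (ss_Z (C := C) r p q)) :
    reduction (val z) \in ss_Z (C := C) r.+1 p q.
  apply: reduction_Z; first by lia.
  have -> : r.+1%:Z - 1 = r%:Z by lia.
  exact: (valP z).
have lowerZ (z : submodule (ss_Z (C := C) r.+1 p q)) :
    val z \in ss_Z (C := C) r p q.
  have /andP[Fz Fdz] := valP z; rewrite ss_ZP Fz /=.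
  by apply: (fil_cast Fdz); lia.
pose up (e : ss_page C r p q) : ss_page C r.+1 p q :=
  ss_class (exist (fun c => c \in ss_Z (C := C) r.+1 p q) _ (redZ (repr (e : lquot _)))).
pose down (e : ss_page C r.+1 p q) : ss_page C r p q :=
  ss_class (exist (fun c => c \in ss_Z (C := C) r p q) _ (lowerZ (repr (e : lquot _)))).
have coef_up e : ss_coef (up e) = ss_coef e.
  rewrite ss_coef_class ?(leqW r2) //= coefS page_coef_reduction //.
  by have /andP[] := valP (repr (e : lquot _)).
have coef_down e : ss_coef (down e) = ss_coef e.
  by rewrite ss_coef_class //= -coefS.
have [|phi phiE] := @linear_bundle _ _ _ up.
  move=> a e e'; apply: (ss_coef_inj (leqW r2)).
  by rewrite ss_coefP ?(leqW r2) // !coef_up ss_coefP.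
exists phi; last first.
  move=> z z' zz'; apply: (ss_coef_inj (leqW r2)).
  by rewrite phiE coef_up !ss_coef_class ?(leqW r2) // coefS zz'.
exists down => e; [apply: (ss_coef_inj r2)|apply: (ss_coef_inj (leqW r2))].
  by rewrite coef_down phiE coef_up.
by rewrite phiE coef_up coef_down.
Qed.

Lemma ss_page_rank_late (r : nat) : (2 <= r)%N -> M <= r%:Z ->
  rank1_exactly_in (ss_page C r) [:: (0, 0)].
Proof.
move=> r2 Mr p q; rewrite inE xpair_eqE; case: ifP => pq.
  have [/eqP-> /eqP->] := andP pq.
  apply: (ss_page_free_rank1 r2 (w := v)); last by rewrite page_coef0.
  by rewrite ss_ZP v_fil dv rpred0.
apply: ss_page_zero => // c; rewrite /page_coef pq.
by have -> : (r%:Z < M) = false by lia.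
Qed.

Lemma ss_page_rank_early (r : nat) : (2 <= r)%N -> r%:Z < M ->
  rank1_exactly_in (ss_page C r) [:: (0, 0); (1, 0); (M, - (M - 2))].
Proof.
move=> r2 rM p q; rewrite !inE !xpair_eqE.
case: ifP => [/or3P[]/andP[/eqP-> /eqP->]|pq].
- apply: (ss_page_free_rank1 r2 (w := v)); last by rewrite page_coef0.
  by rewrite ss_ZP v_fil dv rpred0.
- apply: (ss_page_free_rank1 r2 (w := g)).
    by rewrite ss_ZP g_fil dg rpred0.
  by rewrite page_coef1 // e1g //; lia.
- apply: (ss_page_free_rank1 r2 (w := s)).
    by rewrite ss_ZP ds (fil_cast s_fil) ?(fil_cast g_fil) //; lia.
  by rewrite page_coef2 ?e2s //; lia.
apply: ss_page_zero => // c; rewrite /page_coef rM /=.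
have e : 2 - M = - (M - 2) by lia.
by rewrite e; case/norP: (negbT pq) => /negPf-> /norP[/negPf-> /negPf->].
Qed.

Lemma ss_pages :
  [/\ forall r : nat, (2 <= r)%N -> r%:Z < M ->
        rank1_exactly_in (ss_page C r) [:: (0, 0); (1, 0); (M, - (M - 2))],
      forall r : nat, (2 <= r)%N -> r%:Z < M - 1 -> ss_page_eq_next C r &
      forall r : nat, (2 <= r)%N -> M <= r%:Z ->
        rank1_exactly_in (ss_page C r) [:: (0, 0)]].
Proof.
by split; [exact: ss_page_rank_early|exact: ss_page_eq_nextP|exact: ss_page_rank_late].
Qed.

End PageComputation.


(** * Linear extension and concatenation of chains *)

Lemma linear_homotopy (R : comNzRingType) (V : lmodType R) (d h : {linear V -> V}) :
  linear (fun c => c + d (h c) + h (d c)).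
Proof.
by move=> k u w; rewrite !linearP /= [X in X + _ = _]addrACA [LHS]addrACA -!scalerDr.
Qed.

Lemma linear_reduction (R : comNzRingType) (V W : lmodType R) (e0 e1 e2 : {scalar V})
    (v g s : W) :
  linear (fun c => e0 c *: v + e1 c *: g + e2 c *: s).
Proof.
move=> k u w; rewrite !linearP /= !scalerDl -!scalerA.
by rewrite [X in X + _ = _]addrACA [LHS]addrACA -!scalerDr.
Qed.

Section LinExt.
Context (R : comNzRingType) (G : digraph).
Local Notation chains := {malg R[seq G]}.

Lemma linear_lin_ext (phi : {linear chains -> chains}) (f : seq G -> chains) c :
  phi (lin_ext f c) = lin_ext (phi \o f) c.
Proof. by rewrite /lin_ext linear_sum; apply: eq_bigr => s _; rewrite linearZ. Qed.

Lemma eq_lin_ext (f f' : seq G -> chains) (c : chains) :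
  {in msupp c, f =1 f'} -> lin_ext f c = lin_ext f' c.
Proof.
move=> ff'; rewrite /lin_ext big_seq [RHS]big_seq.
by apply: eq_bigr => s sc; rewrite ff'.
Qed.

Lemma lin_extD (f f' : seq G -> chains) (c : chains) :
  lin_ext (fun s => f s + f' s) c = lin_ext f c + lin_ext f' c.
Proof. by rewrite /lin_ext -big_split; apply: eq_bigr => s _; rewrite scalerDr. Qed.

Lemma lin_extB (f f' : seq G -> chains) (c : chains) :
  lin_ext (fun s => f s - f' s) c = lin_ext f c - lin_ext f' c.
Proof.
rewrite /lin_ext -sumrN -big_split; apply: eq_bigr => s _ /=.
by rewrite scalerBr.
Qed.

Lemma lin_ext0 (c : chains) : lin_ext (fun=> 0) c = 0.
Proof. by rewrite /lin_ext big1 // => s _; rewrite scaler0. Qed.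

Lemma lin_ext_id (c : chains) : lin_ext (fun s => << s >>) c = c.
Proof. by rewrite [RHS]chainE. Qed.

Lemma cons_chainU x s : cons_chain x (<< s >> : chains) = << x :: s >>.
Proof. exact: lin_extU. Qed.

Lemma eq_linear_on_msupp (phi psi : {linear chains -> chains}) (c : chains) :
  {in msupp c, forall s, phi << s >> = psi << s >>} -> phi c = psi c.
Proof.
move=> phi_psi; rewrite [c]chainE !linear_sum big_seq [RHS]big_seq.
by apply: eq_bigr => s /phi_psi; rewrite !linearZ /= => ->.
Qed.

(** The functional with values [f] on tuples, routed through multiples of the dummy generator [<<
    [::] >>] so that [lin_ext] supplies linearity. *)
Definition eval_on (f : seq G -> R) (c : chains) : R :=
  (lin_ext (fun s => f s *: << [::] >>) c)@_[::].

Fact eval_on_scalar f : scalar (eval_on f).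
Proof. by move=> a x y; rewrite /eval_on linearP mcoeffD mcoeffZ. Qed.
HB.instance Definition _ f :=
  GRing.isLinear.Build R chains R _ (eval_on f) (eval_on_scalar f).

Lemma eval_onU f s : eval_on f << s >> = f s.
Proof. by rewrite /eval_on lin_extU mcoeffZ mcoeffUU mulr1. Qed.

Lemma eval_on_eq0 f c : {in msupp c, f =1 (fun=> 0)} -> eval_on f c = 0.
Proof.
move=> f0; rewrite /eval_on (@eq_lin_ext _ (fun=> 0)) ?lin_ext0 ?mcoeff0 //.
by move=> s sc; rewrite f0 // scale0r.
Qed.

Lemma drop_repeatingU s :
  drop_repeating (<< s >> : chains) = if nonrepeating s then << s >> else 0.
Proof. by rewrite /drop_repeating lin_extU. Qed.

Definition cat_chain (t : seq G) : chains -> chains :=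
  lin_ext (fun s => << s ++ t >>).
HB.instance Definition _ t := GRing.Linear.on (cat_chain t).

Lemma cat_chainU t s : cat_chain t << s >> = << s ++ t >>.
Proof. exact: lin_extU. Qed.

Lemma cat_chain_nil c : cat_chain [::] c = c.
Proof.
rewrite -[RHS]lin_ext_id; apply: eq_lin_ext => s _.
by rewrite cats0.
Qed.

(** The concatenation product of the algebra of words, with left factor [p]. *)
Definition join_chain (p : chains) : chains -> chains :=
  lin_ext (fun t => cat_chain t p).
HB.instance Definition _ p := GRing.Linear.on (join_chain p).

Lemma join_chainU p t : join_chain p << t >> = cat_chain t p.
Proof. exact: lin_extU. Qed.

Lemma join_chainDl p p' c : join_chain (p + p') c = join_chain p c + join_chain p' c.
Proof.
by rewrite -lin_extD; apply: eq_lin_ext => s _; rewrite linearD.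
Qed.

Lemma join_chainBl p p' c : join_chain (p - p') c = join_chain p c - join_chain p' c.
Proof.
by rewrite -lin_extB; apply: eq_lin_ext => s _; rewrite linearB.
Qed.

Lemma join_chain0l c : join_chain 0 c = 0.
Proof.
by rewrite -[RHS](lin_ext0 c); apply: eq_lin_ext => s _; rewrite linear0.
Qed.

Lemma join_chain_edge x y c :
  join_chain << [:: x; y] >> c = cons_chain x (cons_chain y c).
Proof.
rewrite [RHS](linear_lin_ext (cons_chain x)); apply: eq_lin_ext => s _ /=.
by rewrite cat_chainU /cons_chain lin_extU.
Qed.

(** A Leibniz rule: faces inside [t] are shifted by two places, hence keep their sign. *)
Lemma full_boundary_edge x y t :
  lin_ext (@full_boundary R G) (cat_chain t << [:: x; y] >>)
    = << y :: t >> - << x :: t >> + join_chain << [:: x; y] >> (full_boundary R t).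
Proof.
rewrite cat_chainU lin_extU /= !full_boundary_cons linearB /= cons_chainU join_chain_edge.
by rewrite opprB addrA addrAC.
Qed.

End LinExt.

#[local] Opaque lin_ext cat_chain join_chain cons_chain drop_repeating.

Lemma eq_negb (c : bool) : (c == ~~ c) = false.
Proof. by case: c. Qed.

Lemma neq_eq_negb (c c' : bool) : c != c' -> c = ~~ c'.
Proof. by case: c c' => [] []. Qed.

(** * Walks and distances in a graph made of two arcs with common ends *)

Section TwoArcs.
Context (R : comNzRingType) (G : digraph) (arc : bool -> nat -> G).
Context (len : bool -> nat) (L : bool).
(* [L] is the longer arc; for arcs of equal length either choice will do. *)
Local Notation S := (~~ L).

Context
  (len_gt0 : forall s, (0 < len s)%N)
  (len_le : (len S <= len L)%N)
  (arc_surj : forall x, exists s i, (i <= len s)%N /\ x = arc s i)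
  (arc_inj : forall s i t j, (i <= len s)%N -> (j <= len t)%N ->
     arc s i = arc t j ->
     [\/ s = t /\ i = j, i = 0%N /\ j = 0%N | i = len s /\ j = len t])
  (arc0 : forall s t, arc s 0 = arc t 0)
  (arc_len : forall s t, arc s (len s) = arc t (len t))
  (edgeP : forall x y, edge x y <->
     exists s i, [/\ (i < len s)%N, x = arc s i & y = arc s i.+1]).

Local Notation a := (arc L 0).
Local Notation b := (arc L (len L)).

(** A walk never changes arc: the arcs meet only at the source, which no edge enters, and at the
    sink, which no edge leaves. *)
Lemma walkP x y k : walk_of_length x y k <->
  exists s i, [/\ (i + k <= len s)%N, x = arc s i & y = arc s (i + k)%N].
Proof.
split.
  move=> /asboolP[p [ep lp <-]] {k}; elim: p x ep lp => [|z p IH] x /=.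
    by move=> _ <-; have [s [i [si ->]]] := arc_surj x; exists s, i; rewrite addn0.
  move=> /andP[/edgeP[s [i [si -> ez]]] pz] lp.
  have [t [j [tj ezj ey]]] := IH _ pz lp.
  have jt : (j <= len t)%N by apply: leq_trans tj; apply: leq_addr.
  have := arc_inj si jt; rewrite -ezj ez => /(_ erefl)[[st ij]|[]//|[il jl]].
    by subst; exists t, i; rewrite ey -addSnnS.
  (* The first edge ends at the sink, so the rest of the walk is empty. *)
  exists s, i; have sz : size p = 0%N by lia.
  rewrite sz addn1; split=> //.
  by rewrite ey sz addn0 -ezj ez.
move=> [s [i [ik -> ->]]]; apply/asboolP.
exists [seq arc s j | j <- iota i.+1 k]; rewrite size_map size_iota.
elim: k i ik => [|k IH] i ik /=; first by rewrite addn0.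
have [] := IH i.+1 _; first by rewrite addSnnS.
rewrite addSnnS => -> -> _; rewrite andbT; split=> //.
by apply/edgeP; exists s, i; split=> //; lia.
Qed.

Lemma walk_arc s i j : (i <= j)%N -> (j <= len s)%N ->
  walk_of_length (arc s i) (arc s j) (j - i).
Proof. by move=> ij js; apply/walkP; exists s, i; rewrite subnKC. Qed.

Lemma reach_arc s i j : (i <= j)%N -> (j <= len s)%N -> reach (arc s i) (arc s j).
Proof. by move=> ij js; apply/reachP; exists (j - i)%N; apply: walk_arc. Qed.

Lemma dist_arc_le s i j : (i <= j)%N -> (j <= len s)%N ->
  (odflt 0 (dist (arc s i) (arc s j)) <= j - i)%N.
Proof. by move=> ij js; apply/dist_min/walk_arc. Qed.

Lemma len_short s : (len S <= len s)%N.
Proof.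
have [->//|sL] := eqVneq s L.
by rewrite -(neq_eq_negb sL).
Qed.

(** By [walkP] a shortest walk runs along one arc. It can leave arc [s] only when it joins source to
    sink, and this shortens nothing if [s] is the shorter arc. *)
Lemma dist_arc s i j : (i <= j)%N -> (j <= len s)%N ->
  [|| s == S, i != 0%N | j != len s] ->
  odflt 0%N (dist (arc s i) (arc s j)) = (j - i)%N.
Proof.
move=> ij js short; apply/eqP; rewrite eqn_leq dist_arc_le //=.
have /walkP[t [k [kt ei ej]]] := dist_walk (reach_arc ij js).
move: (odflt _ _) kt ej => d kt ej.
have is_ : (i <= len s)%N by lia.
have kt_ : (k <= len t)%N by lia.
have {}short : [|| (j - i <= len S)%N, i != 0%N | j != len s].
  by case/or3P: short => [/eqP<-|->|->]; rewrite ?orbT // (leq_trans (leq_subr _ _)).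
have sS := len_short s; have tS := len_short t; have s0 := len_gt0 s.
by case: (arc_inj is_ kt_ ei) (arc_inj js kt ej) => [[? ?]|[? ?]|[? ?]] [[? ?]|[? ?]|[? ?]];
  subst; lia.
Qed.

Definition arc_seq (s : bool) : seq G := mkseq (arc s) (len s).+1.

Lemma arc_seqP s x : reflect (exists2 i, (i <= len s)%N & x = arc s i) (x \in arc_seq s).
Proof. by apply: (iffP mapP) => -[i]; rewrite ?mem_iota => ?; exists i; rewrite ?mem_iota. Qed.

Lemma arc_mem s i : (i <= len s)%N -> arc s i \in arc_seq s.
Proof. by move=> si; apply/arc_seqP; exists i. Qed.

Lemma arc_same_inj s i j : (i <= len s)%N -> (j <= len s)%N ->
  arc s i = arc s j -> i = j.
Proof. by move=> si sj /(arc_inj si sj)[[]|[]|[]] *; lia. Qed.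

Lemma arc_seq_uniq s : uniq (arc_seq s).
Proof.
rewrite map_inj_in_uniq ?iota_uniq // => i j.
by rewrite !mem_iota !add0n => /andP[_ si] /andP[_ sj]; apply: arc_same_inj.
Qed.

Definition arc_pos (s : bool) (x : G) : nat := index x (arc_seq s).

Lemma arc_posK s i : (i <= len s)%N -> arc_pos s (arc s i) = i.
Proof.
move=> si; rewrite /arc_pos -[X in index X _](@nth_mkseq _ (arc s 0) (arc s) (len s).+1 i) //.
by rewrite index_uniq ?size_mkseq ?arc_seq_uniq.
Qed.

(* The interior of the long arc, as the short arc contains both endpoints. *)
Definition long_interior (x : G) : bool := x \notin arc_seq S.

Lemma arc_long_interior i : (i <= len L)%N ->
  long_interior (arc L i) = (0 < i < len L)%N.
Proof.
move=> iL; apply/idP/idP => [|i0L].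
  rewrite lt0n => /arc_seqP nS; apply/andP; split; last rewrite ltn_neqAle iL andbT.
    by apply/eqP => i0; apply: nS; exists 0%N; rewrite ?i0 //; apply: arc0.
  by apply/eqP => i0; apply: nS; exists (len S); rewrite ?i0 //; apply: arc_len.
apply/arc_seqP => -[j jS /(arc_inj iL jS)].
by case=> [[/esym/eqP]|[]|[]]; rewrite ?eqb_negLR; [case: (L)|lia|lia].
Qed.

Lemma long_interiorP x : long_interior x ->
  exists2 i, (0 < i)%N /\ (i < len L)%N & x = arc L i.
Proof.
have [s [i [is_ ->]]] := arc_surj x; have [sS|sL] := eqVneq s S.
  by rewrite /long_interior -sS arc_mem.
have sLE : s = L by rewrite (neq_eq_negb sL) negbK.
move: is_; rewrite sLE => iL; rewrite arc_long_interior // => /andP[i0 il].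
by exists i.
Qed.

(** * Geodesic chains and their failure of additivity *)

Local Notation chains := {malg R[seq G]}.

Definition arc_chain (s : bool) (i : nat) : chains :=
  \sum_(0 <= k < i) << [:: arc s k; arc s k.+1] >>.

Lemma arc_chain0 s : arc_chain s 0 = 0.
Proof. exact: big_geq. Qed.

Lemma arc_chainE s i :
  arc_chain s i = \sum_(0 <= k < i) << [:: arc s k; arc s k.+1] >>.
Proof. by []. Qed.

Lemma arc_chainB s i j : (i <= j)%N ->
  arc_chain s j - arc_chain s i = \sum_(i <= k < j) << [:: arc s k; arc s k.+1] >>.
Proof.
by move=> ij; rewrite /arc_chain [X in X - _](big_cat_nat (leq0n i) ij) /= addrAC subrr add0r.
Qed.

(* Both endpoints lie on [S], so the geodesic between them follows the shorter arc.
   Junk value if [y] is not reachable from [x]. *)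
Definition geodesic (x y : G) : chains :=
  let s := if (x \in arc_seq S) && (y \in arc_seq S) then S else L in
  arc_chain s (arc_pos s y) - arc_chain s (arc_pos s x).

Lemma geodesicxx x : geodesic x x = 0.
Proof. exact: subrr. Qed.

Lemma geodesic_arc s i j : (i <= j)%N -> (j <= len s)%N ->
  [|| s == S, i != 0%N | j != len s] ->
  geodesic (arc s i) (arc s j) = arc_chain s j - arc_chain s i.
Proof.
move=> ij js short; have is_ : (i <= len s)%N by lia.
have [sS|sL] := eqVneq s S.
  by rewrite /geodesic -sS !arc_mem //= !arc_posK.
have {}sL : s = L by rewrite (neq_eq_negb sL) negbK.
move: short js is_; rewrite sL eq_negb /= => short js is_.
have nji : ~ (i = 0%N /\ j = len L).
  by case=> i0 jL; move: short; rewrite i0 jL !eqxx.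
rewrite /geodesic; case: ifP => [|_]; last by rewrite !arc_posK.
rewrite -[_ \in _]negbK -[arc L j \in _]negbK -!/(long_interior _).
rewrite (arc_long_interior is_) (arc_long_interior js) => iS.
(* Only the two ends of [L] lie on [S], and the full arc is excluded by hypothesis; for [i = j] both
   sides vanish. *)
have [->|/nji[]] : i = j \/ (i = 0%N /\ j = len L) by lia.
by rewrite !subrr.
Qed.

Lemma reach_geodesic x y : reach x y -> exists s i j,
  [/\ (i <= j)%N, (j <= len s)%N, x = arc s i & y = arc s j] /\
  geodesic x y = arc_chain s j - arc_chain s i /\
  odflt 0%N (dist x y) = (j - i)%N.
Proof.
move=> /reachP[k /walkP[s [i [ik -> ->]]]].
have [short|] := boolP [|| s == S, i != 0%N | (i + k)%N != len s].
  by exists s, i, (i + k)%N; rewrite geodesic_arc ?dist_arc ?leq_addr.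
rewrite !negb_or !negbK => /and3P[_ /eqP-> /eqP->].
(* From source to sink along [L]: pass to the shorter arc, which realises both the geodesic and the
   distance. *)
exists S, 0%N, (len S); rewrite (arc0 s S) (arc_len s S).
by rewrite geodesic_arc ?dist_arc ?eqxx.
Qed.

Definition loop_chain : chains := arc_chain L (len L) - arc_chain S (len S).

Lemma reach_to_end x : reach x b.
Proof.
by have [s [i [si ->]]] := arc_surj x; rewrite (arc_len L s) reach_arc.
Qed.

Lemma reach_from_end y : reach b y -> y = b.
Proof.
move=> /reachP[k /walkP[s [i [ik eb ->]]]]; rewrite (arc_len L s) in eb *.
have is_ : (i <= len s)%N by lia.
have /= ei := arc_same_inj (leqnn _) is_ eb.
by congr arc; lia.
Qed.

#[local] Opaque arc_chain geodesic.

Lemma geodesicD x y z : reach x y -> reach y z ->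
  geodesic x y + geodesic y z - geodesic x z =
    if [&& x == a, long_interior y & z == b] then loop_chain else 0.
Proof.
have a_short : a \in arc_seq S by rewrite (arc0 L S) arc_mem.
have b_short : b \in arc_seq S by rewrite (arc_len L S) arc_mem.
move=> /reachP[k /walkP[s [i [ik -> ->]]]] /reachP[l /walkP[t [j [jl ey ->]]]].
have [k0|k0] := posnP k.
  rewrite k0 addn0 geodesicxx add0r subrr; case: eqP => //= ->.
  by rewrite /long_interior a_short.
have [l0|l0] := posnP l.
  rewrite l0 addn0 -ey geodesicxx addr0 subrr.
  have [->|_] := eqVneq (arc s (i + k)) b; last by rewrite !andbF.
  by rewrite /long_interior b_short andbF.
have jt : (j <= len t)%N by lia.
(* Both walks are now nonempty, so [y] is neither source nor sink and the walks share an arc. *)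
have [[st eij]|[]|[]] := arc_inj ik jt ey; try lia.
subst t j; set m := (i + k + l)%N in jl *.
rewrite (@geodesic_arc s i (i + k)) ?(@geodesic_arc s (i + k) m) //; try by lia.
rewrite [X in X - _]addrC addrA subrK.
have [short|] := boolP [|| s == S, i != 0%N | m != len s].
  rewrite geodesic_arc //; try by lia.
  rewrite subrr; case: ifP => // /and3P[/eqP xa yS /eqP zb].
  have sL : s = L.
    have [//|sL] := eqVneq s L; have sS := neq_eq_negb sL.
    by move: yS; rewrite /long_interior -sS arc_mem.
  have i0 : i = 0%N by apply: (@arc_same_inj s); rewrite ?xa ?sL // -?sL; lia.
  have ml : m = len s by apply: (@arc_same_inj s) => //; rewrite zb sL.
  by move: short; rewrite i0 ml sL !eqxx; case: (L).
(* What remains is the whole of [L], whereas the geodesic from source to sink runs along [S]. *)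
rewrite !negb_or !negbK => /and3P[sS /eqP i0 /eqP ml].
have sL : s = L by rewrite (neq_eq_negb sS) negbK.
have gab : geodesic a b = arc_chain S (len S) - arc_chain S 0.
  by rewrite (arc0 L S) (arc_len L S) geodesic_arc ?eqxx.
rewrite ml i0 add0n sL gab arc_long_interior -?sL; last by lia.
rewrite !eqxx /= ifT ?/loop_chain ?sL; last by lia.
by rewrite !arc_chain0 !subr0.
Qed.

(** Summing [full_boundary_edge] over the edges, the vertex terms telescope. *)
Lemma full_boundary_arc t s i :
  lin_ext (@full_boundary R G) (cat_chain t (arc_chain s i))
    = << arc s i :: t >> - << arc s 0 :: t >> + join_chain (arc_chain s i) (full_boundary R t).
Proof.
elim: i => [|i IH].
  by rewrite arc_chain0 !linear0 subrr join_chain0l addr0.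
have -> : arc_chain s i.+1 = arc_chain s i + << [:: arc s i; arc s i.+1] >>.
  by rewrite !arc_chainE big_nat_recr.
rewrite !linearD /= IH full_boundary_edge join_chainDl addrACA; congr (_ + _).
by rewrite addrC addrA subrK.
Qed.

Lemma full_boundary_geodesic t x y : reach x y ->
  lin_ext (@full_boundary R G) (cat_chain t (geodesic x y))
    = << y :: t >> - << x :: t >> + join_chain (geodesic x y) (full_boundary R t).
Proof.
move=> /reach_geodesic[s [i [j [[_ _ -> ->] [-> _]]]]].
rewrite !linearB /= !full_boundary_arc join_chainBl opprD addrACA; congr (_ + _).
by rewrite opprB addrA subrK.
Qed.

(** * The contracting homotopy and its defect *)

(** The default [b] of [head] treats a 1-tuple as if [b] came next. When [s] is nonempty, the last
    edge of a nonzero geodesic repeats the head of [s]; that term is removed by [drop_repeating] in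
    [contraction]. *)
Definition prepend_geodesic (t : seq G) : chains :=
  if t is x :: s then cat_chain s (geodesic x (head b s)) else 0.

Definition full_contraction : chains -> chains := lin_ext prepend_geodesic.
HB.instance Definition _ := GRing.Linear.on full_contraction.

Lemma full_contractionU t : full_contraction << t >> = prepend_geodesic t.
Proof. exact: lin_extU. Qed.
#[local] Opaque full_contraction.

Lemma full_contraction_cons x y c :
  full_contraction (cons_chain x (cons_chain y c)) = join_chain (geodesic x y) (cons_chain y c).
Proof.
apply: (@eq_linear_on_msupp _ _ (full_contraction \o (cons_chain x \o cons_chain y))
  (join_chain (geodesic x y) \o cons_chain y)) => s _ /=.
by rewrite !cons_chainU join_chainU full_contractionU.
Qed.

Lemma full_homotopy0 x :
  << [:: x] >> + lin_ext (@full_boundary R G) (full_contraction << [:: x] >>)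
    + full_contraction (full_boundary R [:: x]) = << [:: b] >>.
Proof.
have nil0 : full_boundary R ([::] : seq G) = 0 by rewrite /full_boundary big_ord0.
rewrite full_contractionU [prepend_geodesic _]/= full_boundary_geodesic ?reach_to_end //.
rewrite full_boundary_cons nil0 !linear0 !addr0 full_contractionU addr0.
by rewrite addrC subrK.
Qed.

(** Expanding by the Leibniz rule, the terms in which the boundary reaches [s] cancel. A tuple with
    a repeated entry remains, together with [s] preceded by the additivity defect of [geodesicD]. *)
Lemma full_homotopy x y s : reach x y -> reach y (head b s) ->
  << x :: y :: s >> + lin_ext (@full_boundary R G) (full_contraction << x :: y :: s >>)
    + full_contraction (full_boundary R (x :: y :: s))
  = << y :: y :: s >>
    + cat_chain s (if [&& x == a, long_interior y & head b s == b] then loop_chain else 0).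
Proof.
move=> xy yz; rewrite -(geodesicD xy yz).
have contrB u v : full_contraction (u - v) = full_contraction u - full_contraction v.
  exact: linearB.
have joinB u v : join_chain (geodesic x y) (u - v)
    = join_chain (geodesic x y) u - join_chain (geodesic x y) v by exact: linearB.
have consB u v : cons_chain x (u - v) = cons_chain x u - cons_chain x v :> chains.
  exact: linearB.
have catD (u v w : chains) :
    cat_chain s (u + v - w) = cat_chain s u + cat_chain s v - cat_chain s w.
  by rewrite linearB linearD.
rewrite full_contractionU [prepend_geodesic _]/= (full_boundary_geodesic _ xy) catD.
rewrite !full_boundary_cons joinB consB !contrB join_chainU cons_chainU full_contraction_cons.
rewrite !full_contractionU /=.
rewrite opprB; set X := << x :: _ >>; set Y := << y :: _ >>.
rewrite [X + _]addrA [X + (Y - X)]addrC subrK.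
rewrite -!addrA; congr (_ + (_ + _)).
by rewrite addrCA addKr.
Qed.

Definition contraction (c : chains) : chains := drop_repeating (full_contraction c).

Fact contraction_linear : linear contraction.
Proof. by move=> k c c'; rewrite /contraction !linearP. Qed.
HB.instance Definition _ :=
  GRing.isLinear.Build R chains chains _ contraction contraction_linear.

Lemma drop_cat_repeating t c : t != [::] -> ~~ nonrepeating t ->
  drop_repeating (cat_chain t c) = 0 :> chains.
Proof.
move=> t0 /(repeatingP t0)[u [x [w ->]]].
rewrite (linear_lin_ext (drop_repeating (G := G))) -[RHS](lin_ext0 c).
apply: eq_lin_ext => s _ /=.
by rewrite drop_repeatingU catA repeating_cat.
Qed.

(** The contraction descends to chains modulo repeating tuples: a repetition in the first two
    entries gives the zero geodesic, and any later one persists in every term. *)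
Lemma contraction_drop c : contraction (drop_repeating c) = contraction c.
Proof.
elim/chain_ind: c => [|k c c' IH IH'|s]; first by rewrite !linear0.
  by rewrite !linearP /= IH IH'.
rewrite drop_repeatingU; have [_ //|ns] := boolP (nonrepeating s); rewrite linear0.
rewrite /contraction full_contractionU.
case: s ns => [|x s] ns /=; first by rewrite linear0.
have [s0|s0] := eqVneq s [::]; first by move: ns; rewrite s0.
have [ns'|ns'] := boolP (nonrepeating s); last by rewrite drop_cat_repeating.
case: s s0 ns ns' => //= y s _ ns ns'.
have [<-|xy] := eqVneq x y; first by rewrite geodesicxx !linear0.
by move: ns ns'; rewrite /nonrepeating /= xy /= => /negPf->.
Qed.

Definition loop_cone : chains := drop_repeating (cat_chain [:: b] loop_chain).

Definition coef0 (t : seq G) : R := (size t == 1%N)%:R.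
(** For a pair, the third vertex of the defect is [b] by default, so no condition on it appears,
    unlike in [coef2]. *)
Definition coef1 (t : seq G) : R :=
  (if t is [:: x; y] then (x == a) && long_interior y else false)%:R.
Definition coef2 (t : seq G) : R :=
  (if t is [:: x; y; z] then [&& x == a, long_interior y & z == b] else false)%:R.

Lemma rc_tuple_nonrepeating (t : seq G) : rc_tuple t -> nonrepeating t.
Proof.
move=> /andP[t0 rt]; rewrite /nonrepeating t0.
by apply: sub_sorted rt => x y /= /andP[].
Qed.

Lemma drop_arc_chain s i : (i <= len s)%N -> drop_repeating (arc_chain s i) = arc_chain s i.
Proof.
move=> si; rewrite !arc_chainE big_nat linear_sum; apply: eq_bigr => k /andP[_ ki] /=.
rewrite drop_repeatingU ifT // /nonrepeating /= andbT.
by apply/eqP => /arc_same_inj; lia.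
Qed.

Lemma drop_loop_chain : drop_repeating loop_chain = loop_chain.
Proof. by rewrite linearB /= !drop_arc_chain. Qed.

Lemma contraction_homotopy_tuple t : rc_tuple t ->
  << t >> + rc_boundary (contraction << t >>) + contraction (rc_boundary << t >>)
    = coef0 t *: << [:: b] >> + coef1 t *: loop_chain + coef2 t *: loop_cone.
Proof.
move=> rt; have nt := rc_tuple_nonrepeating rt.
have -> : << t >> + rc_boundary (contraction << t >>) + contraction (rc_boundary << t >>)
  = drop_repeating (<< t >> + lin_ext (@full_boundary R G) (full_contraction << t >>)
    + full_contraction (full_boundary R t)).
  rewrite !linearD /= drop_repeatingU nt -/(contraction _) -/(contraction _).
  rewrite {1}/contraction rc_boundary_drop.
  rewrite [rc_boundary (full_contraction _)]rc_boundaryE.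
  by rewrite rc_boundaryE contraction_drop lin_extU.
case: t rt nt => [|x [|y s]] // rt nt.
  by rewrite full_homotopy0 drop_repeatingU /coef0 /coef1 /coef2 /= !scale0r scale1r !addr0.
have /andP[/andP[xny xy] ys] : (x != y) && reach x y && path [rel x y | (x != y) && reach x y] y s.
  by case/andP: rt.
have yz : reach y (head b s).
  by case: (s) ys => [|z s'] /=; [rewrite reach_to_end|case/andP=> /andP[]].
rewrite full_homotopy // linearD /= drop_repeatingU /nonrepeating /= eqxx /= add0r.
rewrite /coef0 /= scale0r add0r; case: s yz ys {rt nt} => [|z s] /=.
  move=> _ _; rewrite eqxx andbT /coef1 /coef2 scale0r addr0 cat_chain_nil.
  by case: ifP; rewrite ?linear0 ?scale0r // scale1r drop_loop_chain.
move=> yz /andP[/andP[ynz _] zs]; rewrite /coef1 /coef2 scale0r add0r.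
case: s zs => [|w s] /= zs.
  case: ifP => [/and3P[_ _ /eqP->]|]; last by rewrite !linear0 scale0r.
  by rewrite scale1r.
rewrite scale0r; case: ifP => [/and3P[_ _ /eqP zb]|]; last by rewrite !linear0.
(* A tuple with nonzero defect stops at its third entry [b]: nothing but [b] is reachable from the
   sink, and consecutive entries differ. *)
case/andP: zs => /andP[/eqP zw zwr] _; case: zw.
by rewrite zb in zwr *; rewrite (reach_from_end zwr).
Qed.

(** * Filtration estimates *)

Lemma tuple_length1 (x : G) : tuple_length [:: x] = 0%N.
Proof. by rewrite /tuple_length /= big_nil. Qed.

Lemma tuple_length_cons (x y : G) s :
  tuple_length [:: x, y & s] = (odflt 0 (dist x y) + tuple_length (y :: s))%N.
Proof. by rewrite /tuple_length /= big_cons. Qed.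

Lemma drop_cat_sum t i j (F : nat -> seq G) :
  drop_repeating (cat_chain t (\sum_(i <= k < j) << F k >>))
    = \sum_(i <= k < j) drop_repeating << F k ++ t >> :> chains.
Proof.
rewrite (linear_sum (cat_chain t)) (linear_sum (drop_repeating (G := G))).
by apply: eq_bigr => k _ /=; rewrite cat_chainU.
Qed.

Lemma drop_repeating_fil p n s : sorted (@reach G) s -> (size s)%:Z = n + 1 ->
  (tuple_length s)%:Z <= p -> drop_repeating << s >> \in rc_fil (R := R) (G := G) p n.
Proof.
move=> rs ss sp; rewrite drop_repeatingU; case: ifP => [/andP[s0 ns]|_]; last exact: rpred0.
apply: rc_filU => //; rewrite /rc_tuple s0 /=.
case: s {ss sp s0} rs ns => //= x s.
by elim: s x => //= y s IH x /andP[-> /IH rs] /andP[-> /rs].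
Qed.

Lemma arc_cat_fil s k t p n :
  (k < len s)%N -> sorted (@reach G) (arc s k.+1 :: t) -> (size t)%:Z = n - 1 ->
  (tuple_length (arc s k.+1 :: t))%:Z <= p - 1 ->
  drop_repeating << [:: arc s k, arc s k.+1 & t] >> \in rc_fil (R := R) (G := G) p n.
Proof.
move=> ks rt st lt; apply: drop_repeating_fil.
- by rewrite /= reach_arc.
- by rewrite /=; lia.
by rewrite tuple_length_cons; have := dist_arc_le (leqnSn k) ks; lia.
Qed.

(** In a longer tuple, the prepended edge lies on the geodesic to the second entry, so its length is
    offset by the shorter remaining distance. A 1-tuple has length 0 and its contraction consists of
    edges, whence the shift by 1. *)
Lemma contraction_fil_tuple t : rc_tuple t ->
  contraction << t >> \in rc_fil (R := R) (G := G) ((tuple_length t)%:Z + 1) (size t)%:Z.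
Proof.
case: t => // x s /= rt.
have {}rt : path (@reach G) x s by apply: sub_path rt => u w /andP[].
have xz : reach x (head b s) by case: s rt => [|y s] /=; [rewrite reach_to_end|move=> /andP[]].
rewrite /contraction full_contractionU /=.
have [s' [i [j [[ij js ex ez] [-> dxz]]]]] := reach_geodesic xz.
rewrite arc_chainB // drop_cat_sum big_nat rpred_sum // => k /andP[ik kj] /=.
 apply: arc_cat_fil; try by rewrite /=; lia.
  case: s rt {xz dxz} ez => //= y s /andP[_ ->] ->.
  by rewrite reach_arc.
case: s rt {xz} ez dxz => [|y s] /=; first by rewrite !tuple_length1.
rewrite !tuple_length_cons => _ -> ->.
by have := dist_arc_le kj js; lia.
Qed.

Lemma contraction_fil p n c :
  c \in rc_fil (R := R) (G := G) p n -> contraction c \in rc_fil (R := R) (G := G) (p + 1) (n + 1).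
Proof.
move=> /asboolP Fc; rewrite [c]chainE linear_sum big_seq rpred_sum // => s /Fc[ts ss ls].
rewrite linearZ rpredZ //=; have := contraction_fil_tuple ts; rewrite ss.
by apply: rc_fil_mono; rewrite lerD2r.
Qed.

Lemma contraction_homotopy p n c : c \in rc_fil (R := R) (G := G) p n ->
  c + rc_boundary (contraction c) + contraction (rc_boundary c)
  = eval_on coef0 c *: << [:: b] >> + eval_on coef1 c *: loop_chain
    + eval_on coef2 c *: loop_cone.
Proof.
move=> /asboolP Fc.
have [phi phiE] := linear_bundle (linear_homotopy (@rc_boundary R G) contraction).
have [psi psiE] := linear_bundle (linear_reduction (eval_on coef0) (eval_on coef1)
  (eval_on coef2) << [:: b] >> loop_chain loop_cone).
rewrite -[LHS]phiE -[RHS]psiE; apply: eq_linear_on_msupp => s /Fc[ts _ _].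
rewrite phiE psiE /=.
rewrite (contraction_homotopy_tuple ts) !eval_onU.
reflexivity.
Qed.

Lemma coef0_eq0 p n c : c \in rc_fil (R := R) (G := G) p n -> (n != 0) || (p < 0) ->
  eval_on coef0 c = 0.
Proof.
move=> /asboolP Fc np; apply: eval_on_eq0 => s /Fc[_ ss ls].
by rewrite /coef0; case: eqP => // s1; lia.
Qed.

Lemma coef1_eq0 p n c : c \in rc_fil (R := R) (G := G) p n ->
  [|| n != 1, p < 1 | (len L)%:Z <= 1] ->
  eval_on coef1 c = 0.
Proof.
move=> /asboolP Fc np; apply: eval_on_eq0 => s /Fc[rs ss ls].
rewrite /coef1; case: s rs ss ls => [|x [|y [|]]] //= rs ss ls.
case: andP => // -[/eqP xa /long_interiorP[i [i0 iL] yi]]; exfalso.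
by move: ls; rewrite tuple_length_cons tuple_length1 xa yi dist_arc //; lia.
Qed.

(** A tuple [(a, y, b)] through the interior of [L] has length exactly [len L], since neither step
    joins source to sink; such a [y] exists only if [len L > 1]. *)
Lemma coef2_eq0 p n c : c \in rc_fil (R := R) (G := G) p n ->
   [|| n != 2, p < (len L)%:Z | (len L)%:Z <= 1] -> eval_on coef2 c = 0.
Proof.
move=> /asboolP Fc np; apply: eval_on_eq0 => s /Fc[rs ss ls].
rewrite /coef2; case: s rs ss ls => [|x [|y [|z [|]]]] //= rs ss ls.
case: and3P => // -[/eqP xa /long_interiorP[i [i0 iL] yi] /eqP zb]; exfalso.
by move: ls; rewrite !tuple_length_cons tuple_length1 xa yi zb !dist_arc //; lia.
Qed.

(** * The three generators: end vertex, loop and cone *)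

Lemma end_fil : << [:: b] >> \in rc_fil (R := R) (G := G) 0 0.
Proof. by apply: rc_filU => //; rewrite tuple_length1. Qed.

Lemma loop_chain_fil : loop_chain \in rc_fil (R := R) (G := G) 1 1.
Proof.
rewrite -drop_loop_chain -[loop_chain]cat_chain_nil /loop_chain !linearB submodB //=;
  rewrite drop_cat_sum big_nat rpred_sum // => k ks;
  by apply: arc_cat_fil => //; rewrite ?tuple_length1.
Qed.

Lemma loop_cone_fil : loop_cone \in rc_fil (R := R) (G := G) (len L)%:Z 2.
Proof.
have half s : drop_repeating (cat_chain [:: b] (arc_chain s (len s)))
    \in rc_fil (R := R) (G := G) (len L)%:Z 2.
  have sL : (len s <= len L)%N.
    by have [->//|/neq_eq_negb->] := eqVneq s L.
  rewrite arc_chainE drop_cat_sum big_nat rpred_sum // => k /andP[_ ks].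
  apply: arc_cat_fil => //=; first by rewrite reach_to_end.
  rewrite tuple_length_cons tuple_length1 (arc_len L s).
  by have := dist_arc_le ks (leqnn _); lia.
by rewrite /loop_cone !linearB submodB ?half.
Qed.

Lemma rc_boundary_end : rc_boundary << [:: b] >> = 0 :> chains.
Proof.
rewrite rc_boundaryE lin_extU full_boundary_cons /full_boundary big_ord0.
by rewrite linear0 subr0 drop_repeatingU.
Qed.

(** The two arcs share both ends, so the vertex terms of [full_boundary_arc] cancel. *)
Lemma full_boundary_loop t :
  lin_ext (@full_boundary R G) (cat_chain t loop_chain)
    = join_chain loop_chain (full_boundary R t).
Proof.
rewrite /loop_chain linearB linearB /= !full_boundary_arc join_chainBl.
rewrite (arc0 S L) (arc_len S L) opprD addrACA subrr add0r.
by [].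
Qed.

Lemma rc_boundary_loop : rc_boundary loop_chain = 0.
Proof.
rewrite rc_boundaryE -[loop_chain]cat_chain_nil full_boundary_loop.
by rewrite /full_boundary big_ord0 !linear0.
Qed.

Lemma rc_boundary_cone : rc_boundary loop_cone = loop_chain.
Proof.
rewrite /loop_cone rc_boundary_drop rc_boundaryE full_boundary_loop full_boundary_cons.
rewrite /full_boundary big_ord0 linear0 subr0 join_chainU cat_chain_nil.
exact: drop_loop_chain.
Qed.

Lemma coef0_end : eval_on coef0 << [:: b] >> = 1.
Proof. by rewrite eval_onU. Qed.

(** Only the first edge of [L] counts: later edges do not start at [a], and edges of [S] do not end
    in the interior of [L]. *)
Lemma coef1_loop : 1 < (len L)%:Z -> eval_on coef1 loop_chain = 1.
Proof.
move=> /[!ltz_nat] L1; rewrite /loop_chain linearB /= !arc_chainE !linear_sum /=.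
rewrite [X in _ - X]big_nat [X in _ - X]big1 => [|k ks]; last first.
  by rewrite eval_onU /coef1 /long_interior arc_mem ?andbF.
rewrite subr0 big_ltn // eval_onU /coef1 eqxx arc_long_interior ?L1 //=.
rewrite big_nat big1 ?addr0 // => k /andP[k0 kL].
rewrite eval_onU /coef1; case: eqP => //= /arc_same_inj k_eq0.
by have := k_eq0 (ltnW kL) (leq0n _); lia.
Qed.

Lemma two_arcs_pages : let C := reachability_complex R G in
  [/\ forall r : nat, (2 <= r)%N -> r%:Z < (len L)%:Z ->
        rank1_exactly_in (ss_page C r)
          [:: (0, 0); (1, 0); ((len L)%:Z, - ((len L)%:Z - 2))],
      forall r : nat, (2 <= r)%N -> r%:Z < (len L)%:Z - 1 -> ss_page_eq_next C r &
      forall r : nat, (2 <= r)%N -> (len L)%:Z <= r%:Z ->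
        rank1_exactly_in (ss_page C r) [:: (0, 0)]].
Proof.
exact: (@ss_pages R (reachability_complex R G) contraction (eval_on coef0) (eval_on coef1)
  (eval_on coef2) << [:: b] >> loop_chain loop_cone (len L)%:Z contraction_fil
  contraction_homotopy coef0_eq0 coef1_eq0 coef2_eq0 end_fil loop_chain_fil loop_cone_fil
  rc_boundary_end rc_boundary_loop rc_boundary_cone coef0_end coef1_loop).
Qed.

End TwoArcs.

(** * The bi-directed cycle as a union of two arcs *)

Section Bicycle.
Context (m n : nat) (m_gt0 : (0 < m)%N) (n_gt0 : (0 < n)%N).

Definition bicycle_len (s : bool) : nat := if s then n else m.

Definition bicycle_pos (s : bool) (i : nat) : nat :=
  if s then second_arc m n i else i.

Fact bicycle_pos_lt s i : (bicycle_pos s i < m + n)%N || (bicycle_len s < i)%N.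
Proof.
rewrite /bicycle_pos /bicycle_len /second_arc.
by case: s; [case: eqP => ?; last case: eqP => ?|]; lia.
Qed.

Fact bicycle_gt0 : (0 < m + n)%N.
Proof. by rewrite addn_gt0 m_gt0. Qed.

(* Junk value 0 beyond the end of an arc. *)
Definition bicycle_arc (s : bool) (i : nat) : bicycle m n :=
  insubd (Ordinal bicycle_gt0) (bicycle_pos s i).

Lemma bicycle_arcE s i : (i <= bicycle_len s)%N ->
  bicycle_arc s i = bicycle_pos s i :> nat.
Proof. by move=> si; rewrite insubdK // -topredE /=; have := bicycle_pos_lt s i; lia. Qed.

Lemma bicycle_len_gt0 s : (0 < bicycle_len s)%N.
Proof. by case: s. Qed.

Lemma bicycle_arc_surj x : exists s i, (i <= bicycle_len s)%N /\ x = bicycle_arc s i.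
Proof.
have := ltn_ord x; have [xm _|mx xmn] := leqP x m.
  by exists false, (x : nat); split=> //; apply: ord_inj; rewrite bicycle_arcE.
exists true, (x - m)%N; have le : (x - m <= n)%N by lia.
split=> //; apply: ord_inj; rewrite bicycle_arcE //= /second_arc.
by case: eqP => ?; last case: eqP => ?; lia.
Qed.

Lemma bicycle_arc_inj s i t j :
  (i <= bicycle_len s)%N -> (j <= bicycle_len t)%N -> bicycle_arc s i = bicycle_arc t j ->
  [\/ s = t /\ i = j, i = 0%N /\ j = 0%N | i = bicycle_len s /\ j = bicycle_len t].
Proof.
move=> si tj /(congr1 (@nat_of_ord _)); rewrite !bicycle_arcE //.
case: s t si tj => [] [] /= si tj; rewrite /second_arc;
  try (case: eqP => ?; last case: eqP => ?); try (case: eqP => ?; last case: eqP => ?);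
  move=> e; try by [constructor 1; split; lia | constructor 2; lia | constructor 3; lia].
Qed.

Lemma bicycle_arc0 s t : bicycle_arc s 0 = bicycle_arc t 0.
Proof. by apply: ord_inj; rewrite !bicycle_arcE //; case: s t => [] []. Qed.

Lemma bicycle_arc_len s t : bicycle_arc s (bicycle_len s) = bicycle_arc t (bicycle_len t).
Proof.
apply: ord_inj; rewrite !bicycle_arcE //.
by case: s t => [] [] //=; rewrite /second_arc eqxx; case: eqP => ?; lia.
Qed.

Lemma bicycle_edgeP (x y : bicycle m n) : edge x y <->
  exists s i, [/\ (i < bicycle_len s)%N, x = bicycle_arc s i & y = bicycle_arc s i.+1].
Proof.
split.
  case/orP=> /existsP[i /andP[/eqP xi /eqP yi]]; [exists false, i|exists true, i];
  by split; [exact: ltn_ord|apply: ord_inj; rewrite bicycle_arcE // ltnW|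
    apply: ord_inj; rewrite bicycle_arcE].
move=> [s [i [si -> ->]]]; apply/orP.
case: s si => si; [right|left]; apply/existsP; exists (Ordinal si);
by rewrite !bicycle_arcE ?eqxx // ltnW.
Qed.

End Bicycle.

#[local] Unset Implicit Arguments.

Theorem theorem9p3 (R : comNzRingType) (m n : nat)
    (m_ge1 : (1 <= m)%N) (n_ge1 : (1 <= n)%N) :
  let G := bicycle m n in
  let M := maxn m n in
  let PH := fun i j : int => path_homology R G (i + j) i in
  ((3 <= M)%N ->
     [/\ rank1_exactly_in PH [:: (0, 0); (1, 0); (M%:Z, - (M%:Z - 2))],
         (forall r : nat, (2 <= r)%N -> (r < M.-1)%N ->
            ss_page_eq_next (reachability_complex R G) r)
       & rank1_exactly_in (mpss_page R G M) [:: (0, 0)]]) /\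
  (M = 1%N \/ M = 2%N -> rank1_exactly_in PH [:: (0, 0)]).
Proof.
move=> G M PH.
have PHE i j : PH i j = mpss_page R G 2 i j.
  by rewrite /PH /path_homology; congr (mpss_page _ _ _ _ _); rewrite addrC addKr.
have rank_PH S : rank1_exactly_in (mpss_page R G 2) S -> rank1_exactly_in PH S.
  by move=> rk i j; rewrite PHE; apply: rk.
(* [true] names the arc with [n] edges, so this picks the longer arc, and the first one in a tie. *)
pose L := (m < n)%N.
have lenL : bicycle_len m n L = M.
  by rewrite /bicycle_len /L /M; case: ifP; lia.
have len_le : (bicycle_len m n (~~ L) <= bicycle_len m n L)%N.
  by rewrite /bicycle_len /L; case: ltnP => /=; lia.
have [early next late] := two_arcs_pages R (bicycle_len_gt0 m_ge1 n_ge1) len_le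
  (bicycle_arc_surj m_ge1 n_ge1) (@bicycle_arc_inj m n m_ge1 n_ge1)
  (@bicycle_arc0 m n m_ge1 n_ge1) (@bicycle_arc_len m n m_ge1 n_ge1)
  (@bicycle_edgeP m n m_ge1 n_ge1).
rewrite lenL in early next late.
split=> [M3|M12].
  split; first by apply/rank_PH/early; lia.
    by move=> r r2 rM; apply: next => //; lia.
  by apply: late => //; lia.
(* For [M <= 2] the loop has already died on the page E^2. *)
by apply/rank_PH/late => //; lia.
Qed.
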